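(* Let $(V,E)$ be an unrooted directed tree, $\mu=(\mu_v)_{v\in V}$ a weight on $V$, and $\Gamma$ a subset of the scalar field $\mathbb{K}$. Let $X=\ell^p(V,\mu)$, $1\leq p<+\infty$, or $X=c_0(V,\mu)$, and suppose that the backward shift $B$ is a bounded operator on $X$. Then the following conditions are equivalent: (1) $B$ is $\Gamma$-supercyclic. (2) $B$ is $\Gamma$-recurrent. (3) There are an increasing sequence of positive integers $(n_k)_{k\geq1}$ and a sequence $(\lambda_k)_{k\geq1}$ in $\Gamma\setminus\{0\}$ such that, for every $v\in V$, as $k\to+\infty$, we have $$\begin{cases}\sum_{u\in\mathrm{Chi}^{n_k}(v)}\dfrac{|\lambda_k|^{p^\ast}}{|\mu_u|^{p^\ast}}\longrightarrow+\infty & \text{if } X=\ell^p(V,\mu),\ 1<p<+\infty;\\[2mm] \inf_{u\in\mathrm{Chi}^{n_k}(v)}\dfrac{|\mu_u|}{|\lambda_k|}\longrightarrow0 & \text{if } X=\ell^1(V,\mu);\\[2mm] \sum_{u\in\mathrm{Chi}^{n_k}(v)}\dfrac{|\lambda_k|}{|\mu_u|}\longrightarrow+\infty & \text{if } X=c_0(V,\mu),\end{cases}$$ and $$\begin{cases}\dfrac{1}{|\lambda_k\,\mu_{\mathrm{par}^{n_k}(v)}|^{p^\ast}}+\sum_{u\in\mathrm{Chi}^{n_k}(\mathrm{par}^{n_k}(v))}\dfrac{1}{|\mu_u|^{p^\ast}}\longrightarrow+\infty & \text{if } X=\ell^p(V,\mu),\ 1<p<+\infty;\\[2mm] \min\Big(|\lambda_k\,\mu_{\mathrm{par}^{n_k}(v)}|,\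 \inf_{u\in\mathrm{Chi}^{n_k}(\mathrm{par}^{n_k}(v))}|\mu_u|\Big)\longrightarrow0 & \text{if } X=\ell^1(V,\mu);\\[2mm] \dfrac{1}{|\lambda_k\,\mu_{\mathrm{par}^{n_k}(v)}|}+\sum_{u\in\mathrm{Chi}^{n_k}(\mathrm{par}^{n_k}(v))}\dfrac{1}{|\mu_u|}\longrightarrow+\infty & \text{if } X=c_0(V,\mu).\end{cases}$$
   Context: $\mathbb{N}_0=\{0,1,2,\ldots\}$, $\mathbb{K}$ is $\mathbb{R}$ or $\mathbb{C}$. Directed tree: a pair $(V,E)$ with $V$ a non-empty countable set (vertices) and $E\subset\{(u,v):u,v\in V,u\neq v\}$ (edges) such that: (i) any two distinct vertices are joined by an undirected path; (ii) there is no circuit, i.e. no sequence $v_1,\ldots,v_n$ of distinct vertices, $n\geq2$, with $(v_j,v_{j+1})\in E$ for $1\le j<n$ and $(v_n,v_1)\in E$; (iii) for each $v\in V$ there is at most one $u\in V$ with $(u,v)\in E$; if it exists it is called the parent of $v$, denoted $\mathrm{par}(v)$. A root is a vertex without parent; the tree is unrooted if it has no root, and then $\mathrm{par}^n(v)$ denotes the $n$-fold iterate of $\mathrm{par}$ at $v$. $\mathrm{Chi}(v)=\{u\in V:\mathrm{par}(u)=v\}$, $\mathrm{Chi}^1(v)=\mathrm{Chi}(v)$, $\mathrm{Chi}^n(v)=\bigcup_{u\in\mathrm{Chi}(v)}\mathrm{Chi}^{n-1}(u)$ for $n\geq2$. Weight on $V$: a family $\mu=(\mu_v)_{v\in V}$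 of non-zero numbers in $\mathbb{K}$. $\ell^p(V,\mu)=\{f\in\mathbb{K}^V:\|f\|_{p,\mu}^p=\sum_{v}|f(v)\mu_v|^p<+\infty\}$ with norm $\|\cdot\|_{p,\mu}$; $c_0(V,\mu)$ is the set of $f\in\mathbb{K}^V$ such that for every $\varepsilon>0$ there is a finite $F\subset V$ with $|f(v)\mu_v|<\varepsilon$ for all $v\in V\setminus F$, with norm $\sup_v|f(v)\mu_v|$. For $1<p<\infty$, $p^\ast=p/(p-1)$. The backward shift is $(Bf)(v)=\sum_{u\in\mathrm{Chi}(v)}f(u)$. An empty sum is $0$, the infimum of the empty set is $+\infty$; sums of non-negative numbers may equal $+\infty$. Increasing sequences of integers are strictly increasing. A bounded operator $T$ on $X$ is $\Gamma$-supercyclic if there is $x\in X$ such that $\{\lambda T^nx:\lambda\in\Gamma,\ n\in\mathbb{N}_0\}$ is dense in $X$. A vector $x\in X$ is $\Gamma$-recurrent for $T$ if there exist a strictly increasing sequence $(n_k)_{k\geq1}$ of positive integers and a sequence $(\lambda_k)_{k\geq1}$ in $\Gamma$ with $\lambda_kT^{n_k}x\to x$; $T$ is $\Gamma$-recurrent if its set of $\Gamma$-recurrent vectors is dense in $X$. *)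

(* Defs.v *)
From HB Require Import structures.
From mathcomp Require Import all_boot all_order all_algebra.
From mathcomp Require Import finmap complex.
From mathcomp Require Import all_classical all_reals all_analysis.

Set Implicit Arguments.
Unset Strict Implicit.
Unset Printing Implicit Defensive.

Import Order.TTheory GRing.Theory Num.Theory.
Import numFieldNormedType.Exports.

Local Open Scope classical_set_scope.
Local Open Scope ring_scope.

Variant scalar_kind := RealScalars | ComplexScalars.

Definition scalar_field (R : realType) (b : scalar_kind) : numFieldType :=
  match b with
  | RealScalars => R : numFieldType
  | ComplexScalars => R[i] : numFieldType
  end.

(* The norm of the [numFieldType] R[i] takes its values in R[i] itself;
   [modulus] is the real-valued absolute value for both kinds of scalars. *)
Definition modulus (R : realType) (b : scalar_kind) : scalar_field R b -> R :=
  match b return scalar_field R b -> R with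
  | RealScalars => fun x : R => `|x|
  | ComplexScalars => fun z : R[i] => Normc.normc z
  end.

Section DirectedTree.
Variables (V : countType) (E : rel V).

Record directed_tree : Prop := DirectedTree {
  tree_nonempty : [set: V] !=set0;
  tree_irreflexive : forall u, ~~ E u u;
  tree_connected : forall u v, u != v ->
    exists2 s : seq V, path (fun x y => E x y || E y x) u s & last u s = v;
  tree_acyclic : forall s : seq V, (1 < size s)%N -> uniq s -> ~~ cycle E s;
  tree_parent_unique : forall u u' v, E u v -> E u' v -> u = u'
}.

Definition is_root (v : V) : Prop := ~ exists u, E u v.

Definition unrooted : Prop := ~ exists v, is_root v.

(* At a root, which has no parent, this takes the dummy value [v]. *)
Definition par (v : V) : V := xget v [set u | E u v].

Definition Chi (v : V) : set V := [set u | E v u].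

(* [Chin 0 v] is [set v], so that [Chin 1 v] is [Chi v]. *)
Fixpoint Chin (n : nat) (v : V) : set V :=
  if n is m.+1 then \bigcup_(u in Chi v) Chin m u else [set v].

End DirectedTree.

Section UnorderedSum.
Variables (R : realType) (b : scalar_kind) (V : choiceType).
Local Notation K := (scalar_field R b).

(* Convergence of the net of finite partial sums; over the scalars this is the
   same as absolute convergence, and [esum] only covers nonnegative terms. *)
Definition has_sum (D : set V) (f : V -> K) (s : K) : Prop :=
  forall e : R, 0 < e -> exists2 A : {fset V}, [set` A] `<=` D &
    forall A' : {fset V}, [set` A'] `<=` D -> [set` A] `<=` [set` A'] ->
      modulus (\sum_(u <- A') f u - s) < e.

Definition summable_on (D : set V) (f : V -> K) : Prop :=
  exists s, has_sum D f s.

(* 0 when the family is not summable. *)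
Definition unordered_sum (D : set V) (f : V -> K) : K :=
  xget 0 [set s | has_sum D f s].

End UnorderedSum.

Variant space_kind (R : realType) := Ellp of R | C0.
Arguments C0 {R}.

Definition admissible (R : realType) (X : space_kind R) : Prop :=
  match X with Ellp p => 1 <= p | C0 => True end.

Definition conj_exponent (R : realType) (p : R) : R := p / (p - 1).

Section WeightedSpace.
Variables (R : realType) (b : scalar_kind) (V : countType).
Local Notation K := (scalar_field R b).
Variables (mu : V -> K) (X : space_kind R).

Definition in_space : set (V -> K) :=
  match X with
  | Ellp p =>
      [set f | (\esum_(v in [set: V]) (modulus (f v * mu v) `^ p)%:E < +oo)%E]
  | C0 =>
      [set f | forall e : R, 0 < e -> exists F : {fset V},
        forall v, v \notin F -> modulus (f v * mu v) < e]
  end.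

Definition space_norm (f : V -> K) : R :=
  match X with
  | Ellp p =>
      fine (\esum_(v in [set: V]) (modulus (f v * mu v) `^ p)%:E) `^ p^-1
  | C0 => sup [set modulus (f v * mu v) | v in [set: V]]
  end.

Definition space_ball (f : V -> K) (e : R) : set (V -> K) :=
  [set g | in_space g /\ space_norm (g \- f) < e].

Definition dense_in_space (A : set (V -> K)) : Prop :=
  forall f, in_space f -> forall e : R, 0 < e -> A `&` space_ball f e !=set0.

Definition supercyclic (Gamma : set K) (T : (V -> K) -> (V -> K)) : Prop :=
  exists2 x, in_space x & dense_in_space
    [set y | exists2 l, Gamma l & exists n : nat, y = l \*o iter n T x].

Definition recurrent_vector (Gamma : set K) (T : (V -> K) -> (V -> K))
    (x : V -> K) : Prop :=
  in_space x /\ exists (n : nat -> nat) (l : nat -> K),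
    [/\ (forall k, 0 < n k)%N, (forall k, n k < n k.+1)%N,
        (forall k, Gamma (l k)) &
        space_norm (l k \*o iter (n k) T x \- x) @[k --> \oo] --> (0 : R)].

Definition recurrent (Gamma : set K) (T : (V -> K) -> (V -> K)) : Prop :=
  dense_in_space [set x | recurrent_vector Gamma T x].

End WeightedSpace.

Section BackwardShift.
Variables (R : realType) (b : scalar_kind) (V : countType) (E : rel V).
Local Notation K := (scalar_field R b).

Definition backward_shift (f : V -> K) : V -> K :=
  fun v => unordered_sum (Chi E v) f.

(* Linearity is automatic once all the defining sums converge. *)
Record bounded_backward_shift (mu : V -> K) (X : space_kind R) : Prop :=
  BoundedBackwardShift {
  shift_defined : forall f, in_space mu X f ->
    forall v, summable_on (Chi E v) f;
  shift_stable : forall f, in_space mu X f -> in_space mu X (backward_shift f);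
  shift_bounded : exists C : R, forall f, in_space mu X f ->
    space_norm mu X (backward_shift f) <= C * space_norm mu X f
}.

End BackwardShift.

(* Main.v *)
(* Let |f|_D be the norm of f restricted to D. Call a set D of vertices e-thin
   if some finitely supported g on D has sum 1 and norm at most e. By duality
   between l^p and l^{p*} (resp. l^1 and l^oo, c_0 and l^1), the two limits in
   (3) say that, with n = n_k and l = l_k, eventually Chi^n(v) is e|l|-thin, and
   either |l mu(par^n v)| <= e or Chi^n(par^n v) is e-thin.

   (1) => (2): the line spanned by a supercyclic vector x is nowhere dense, so
   the vectors l B^n x with n >= 1 are still dense; hence B has dense range, the
   vectors l B^n x with n >= N are dense for every N, and x is recurrent.

   (2) => (3): let y be a finitely supported approximation of a recurrent vector
   close to the indicator of a finite set F, with l B^n y close to y. For v in F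
   the sum of y over Chi^n(v) is about 1 / l, while y is small there because
   Chi^n(v) avoids F; this gives the first condition. For w = par^n v, not in F,
   |l mu_w| times the sum of y over Chi^n(w) is small, while the part of that sum
   over F is at least about 1; so either |l mu_w| is small or the part of the sum
   outside F, where y is small, is bounded below.

   (3) => (1): the pairs (y, z) such that some d of small norm makes
   l_k B^{n_k} (y + d) close to z for all large k form a linear subspace.
   The first condition puts (0, e_v) into it, the second one (e_v, 0), so it
   contains a dense set of pairs; nested balls then yield a supercyclic vector. *)

Require Import Defs.
From HB Require Import structures.
From mathcomp Require Import all_boot all_order all_algebra.
From mathcomp Require Import finmap complex.
From mathcomp Require Import all_classical all_reals all_analysis.
From mathcomp Require Import ring lra.

Set Implicit Arguments.
Unset Strict Implicit.
Unset Printing Implicit Defensive.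

Import Order.TTheory GRing.Theory Num.Theory.
Import numFieldNormedType.Exports.

Local Open Scope classical_set_scope.
Local Open Scope ring_scope.

(** * Scalars *)

Section Scalars.
Variables (R : realType) (b : scalar_kind).
Local Notation K := (scalar_field R b).
Implicit Types x y z : K.

Definition of_real : R -> K :=
  match b return R -> scalar_field R b with
  | RealScalars => fun r => r
  | ComplexScalars => fun r => (r%:C)%C
  end.

(** A countable dense set of scalars with one index type for both kinds of scalars, so that finite
    rational combinations of vertices can be enumerated. *)
Definition of_rat2 (q : rat * rat) : K :=
  match b return scalar_field R b with
  | RealScalars => ratr q.1 : R
  | ComplexScalars => ((ratr q.1 : R) +i* (ratr q.2 : R))%C
  end.

Lemma modulus_ge0 x : 0 <= modulus x.
Proof.
by move: x; rewrite /modulus; case: b => [x|[r i]]; [exact: normr_ge0|exact: sqrtr_ge0].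
Qed.

Lemma modulus_eq0 x : (modulus x == 0) = (x == 0).
Proof.
move: x; rewrite /modulus; case: b => [x|x]; first exact: normr_eq0.
by apply/eqP/eqP => [/Normc.eq0_normc|->] //; exact: Normc.normc0.
Qed.

Lemma modulus0 : modulus (0 : K) = 0.
Proof. by apply/eqP; rewrite modulus_eq0. Qed.

Lemma modulus_gt0 x : (0 < modulus x) = (x != 0).
Proof. by rewrite lt_def modulus_eq0 modulus_ge0 andbT. Qed.

Lemma modulusM x y : modulus (x * y) = modulus x * modulus y.
Proof.
by move: x y; rewrite /modulus; case: b => x y; [exact: normrM|exact: Normc.normcM].
Qed.

Lemma modulusD x y : modulus (x + y) <= modulus x + modulus y.
Proof.
by move: x y; rewrite /modulus; case: b => x y; [exact: ler_normD|exact: le_normcD].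
Qed.

Lemma modulus_of_real r : modulus (of_real r) = `|r|.
Proof.
rewrite /modulus /of_real; case: b => //=.
by rewrite expr0n addr0 sqrtr_sqr.
Qed.

Lemma of_realD : {morph of_real : r s / r + s}.
Proof. by rewrite /of_real; case: b => // r s; rewrite rmorphD. Qed.

Lemma of_real0 : of_real 0 = 0.
Proof. by rewrite /of_real; case: b. Qed.

Lemma of_real1 : of_real 1 = 1.
Proof. by rewrite /of_real; case: b. Qed.

Lemma of_real_sum (I : Type) (s : seq I) (P : pred I) (F : I -> R) :
  of_real (\sum_(i <- s | P i) F i) = \sum_(i <- s | P i) of_real (F i).
Proof. exact: (big_morph _ of_realD of_real0). Qed.

Lemma modulus1 : modulus (1 : K) = 1.
Proof. by rewrite -of_real1 modulus_of_real normr1. Qed.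

Lemma modulusN x : modulus (- x) = modulus x.
Proof.
have : modulus (-1 : K) * modulus (-1 : K) = 1.
  by rewrite -modulusM mulrNN mulr1 modulus1.
move=> /eqP; rewrite -expr2 sqrf_eq1 => /orP[/eqP h|/eqP h].
  by rewrite -mulN1r modulusM h mul1r.
by have := modulus_ge0 (-1); rewrite h oppr_ge0 ler10.
Qed.

Lemma modulusB x y : modulus (x - y) = modulus (y - x).
Proof. by rewrite -modulusN opprB. Qed.

Lemma modulusV x : modulus x^-1 = (modulus x)^-1.
Proof.
have [->|x0] := eqVneq x 0; first by rewrite invr0 modulus0 invr0.
have mx0 : modulus x != 0 by rewrite modulus_eq0.
by apply: (mulIf mx0); rewrite -modulusM !mulVf// modulus1.
Qed.

Lemma modulus_nat n : modulus (n%:R : K) = n%:R.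
Proof.
have -> : (n%:R : K) = of_real n%:R; last by rewrite modulus_of_real normr_nat.
elim: n => [|n IH]; first by rewrite of_real0.
by rewrite -!natr1 of_realD -IH of_real1.
Qed.

Lemma modulus_sum (I : Type) (s : seq I) (P : pred I) (F : I -> K) :
  modulus (\sum_(i <- s | P i) F i) <= \sum_(i <- s | P i) modulus (F i).
Proof.
elim/big_rec2: _ => [|i y x _ xy]; first by rewrite modulus0.
by apply: (le_trans (modulusD _ _)); rewrite lerD2l.
Qed.

Lemma modulusB_ge x y : modulus x - modulus y <= modulus (x - y).
Proof. by rewrite lerBlDr -{1}(subrK y x); exact: modulusD. Qed.

Lemma modulusB_tri x y z : modulus (x - z) <= modulus (x - y) + modulus (y - z).
Proof. by rewrite -{1}(subrK y x) -addrA; exact: modulusD. Qed.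

Lemma of_rat2_dense x (e : R) : 0 < e ->
  exists q, modulus (x - of_rat2 q) < e.
Proof.
have rat_near (r : R) (d : R) : 0 < d -> exists q : rat, `|r - ratr q| < d.
  move=> d0; have [|q] := @rat_in_itvoo R (r - d) (r + d).
    by rewrite ltrBlDr -addrA ltrDl addr_gt0.
  by rewrite in_itv/= => ?; exists q; rewrite distrC ltr_distl.
move: x; rewrite /modulus /of_rat2; case: b => [x|[x y]] e0.
  by have [q hq] := rat_near x _ e0; exists (q, 0).
have e20 : 0 < e / 2 by rewrite divr_gt0.
have [q hq] := rat_near x _ e20; have [q' hq'] := rat_near y _ e20.
exists (q, q').
have -> : ((x +i* y) - (ratr q +i* ratr q') = (x - ratr q)%:C + 'i * (y - ratr q')%:C)%C.
  by apply/eqP; rewrite eq_complex /=; apply/andP; split; apply/eqP; simpc.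
apply: le_lt_trans (le_normcD _ _) _; rewrite Normc.normcM /=.
rewrite !expr0n /= !addr0 add0r expr1n sqrtr1 mul1r !sqrtr_sqr; lra.
Qed.

(* The radii [r n] are moduli of convergence; passing from real to complex
   scalars componentwise costs the factor 2. *)
Lemma scalar_complete (a : nat -> K) (r : nat -> R) :
  (forall n m, (n <= m)%N -> modulus (a m - a n) <= r n) ->
  exists x, forall n, modulus (x - a n) <= 2 * r n.
Proof.
have real_complete (u s : nat -> R) :
    (forall n m, (n <= m)%N -> `|u m - u n| <= s n) ->
    exists x : R, forall n, `|x - u n| <= s n.
  (* The limit is the supremum of the lower bounds [u n - s n], each of which lies below every upper
     bound [u m + s m]. *)
  move=> us; pose S := [set u n - s n | n in [set: nat]].
  have le_us m n : u m - s m <= u n + s n.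
    have := us _ _ (leq_maxl m n); have := us _ _ (leq_maxr m n).
    by rewrite !ler_norml => /andP[? ?] /andP[? ?]; lra.
  have S0 : S !=set0 by exists (u 0 - s 0), 0%N.
  have Sub n : ubound S (u n + s n) by move=> _ [m _ <-].
  exists (sup S) => n; rewrite ler_distl; apply/andP; split.
    by apply: ub_le_sup; [exists (u 0 + s 0)|exists n].
  exact: ge_sup.
move: a; rewrite /modulus; case: b => [a|a] ar.
  have [x hx] := real_complete a r ar.
  by exists x => n; apply: le_trans (hx n) _; have := ar n n (leqnn n);
    rewrite subrr normr0; lra.
have Re_le (z : R[i]) : `|complex.Re z| <= Normc.normc z.
  by case: z => x y /=; rewrite -sqrtr_sqr ler_sqrt ?addr_ge0 ?sqr_ge0// lerDl sqr_ge0.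
have Im_le (z : R[i]) : `|complex.Im z| <= Normc.normc z.
  by case: z => x y /=; rewrite -sqrtr_sqr ler_sqrt ?addr_ge0 ?sqr_ge0// lerDr sqr_ge0.
have [|x hx] := real_complete (fun n => complex.Re (a n)) r.
  by move=> n m nm /=; rewrite -raddfB; exact: le_trans (Re_le _) (ar _ _ nm).
have [|y hy] := real_complete (fun n => complex.Im (a n)) r.
  by move=> n m nm /=; rewrite -raddfB; exact: le_trans (Im_le _) (ar _ _ nm).
exists (x +i* y)%C => n.
have -> : ((x +i* y) - a n = (x - complex.Re (a n))%:C + 'i * (y - complex.Im (a n))%:C)%C.
  by case: (a n) => p q; apply/eqP; rewrite eq_complex /=; apply/andP; split; apply/eqP; simpc.
apply: le_trans (le_normcD _ _) _; rewrite Normc.normcM /=.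
rewrite !expr0n /= !addr0 add0r expr1n sqrtr1 mul1r !sqrtr_sqr.
by have := hx n; have := hy n; rewrite /=; lra.
Qed.

End Scalars.

(** * Norms on finite sets of vertices *)

Section FsetSums.
Variables (R : realType) (V : choiceType).
Implicit Types (D : set V) (A B : {fset V}) (a t : V -> R).

(** Only the terms over the intersection of [A] and [B] survive on the left; the rest of [B] adds
    non-negative terms on the right. *)
Lemma fsum_le A B a t : (forall v, v \in B -> 0 <= t v) ->
    (forall v, v \in A -> a v = 0 \/ v \in B /\ a v <= t v) ->
  \sum_(v <- A) a v <= \sum_(v <- B) t v.
Proof.
move=> t0 at_.
have -> : \sum_(v <- A) a v = \sum_(v <- (A `&` B)%fset) a v.
  apply/esym/big_fset_incl; first exact: fsubsetIl.
  by move=> v vA; rewrite in_fsetI vA /= => vB; case: (at_ v vA) => // -[];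
    rewrite (negbTE vB).
apply: (@le_trans _ _ (\sum_(v <- (A `&` B)%fset) t v)).
  rewrite big_seq [leRHS]big_seq; apply: ler_sum => v.
  by rewrite in_fsetI => /andP[vA vB]; case: (at_ v vA) => [->|[]] //; exact: t0.
rewrite [leRHS](big_fsetID _ (mem A))/= -[leLHS]addr0 lerD//.
  have -> // : [fset x in B | x \in A]%fset = (A `&` B)%fset.
  by apply/fsetP => v; rewrite !inE andbC.
rewrite big_seq; apply: sumr_ge0 => v; rewrite !inE /= => /andP[vB _]; exact: t0.
Qed.

Lemma fsumU A B a : [disjoint A & B]%fset ->
  \sum_(v <- (A `|` B)%fset) a v = \sum_(v <- A) a v + \sum_(v <- B) a v.
Proof.
move=> /fdisjointP AB; rewrite (big_fsetID _ [pred v | v \in A])/=; congr (_ + _).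
  by apply: eq_fbigl => v; rewrite !inE /=; case: (boolP (v \in A)); rewrite ?andbT ?andbF.
apply: eq_fbigl => v; rewrite !inE /=.
by case: (boolP (v \in A)) => [/AB/negbTE->|]; rewrite ?andbT ?andbF.
Qed.

Lemma esum_le_fset D a (c : \bar R) : (forall v, 0 <= a v) ->
    (forall A, [set` A] `<=` D -> ((\sum_(v <- A) a v)%:E <= c)%E) ->
  (\esum_(v in D) (a v)%:E <= c)%E.
Proof.
move=> a0 h; apply: ge_ereal_sup => _ [A [finA AD] <-].
rewrite fsbig_finite// sumEFin; apply: h => v /=.
by rewrite in_fset_set// inE => /AD.
Qed.

Lemma fset_le_esum D a A : (forall v, 0 <= a v) -> [set` A] `<=` D ->
  ((\sum_(v <- A) a v)%:E <= \esum_(v in D) (a v)%:E)%E.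
Proof.
move=> a0 AD; apply: esum_ge; exists [set` A]; first by split.
by rewrite fsbig_finite// set_fsetK sumEFin.
Qed.

Lemma lt_esum_fset D a (c : \bar R) : (forall v, 0 <= a v) ->
    (c < \esum_(v in D) (a v)%:E)%E ->
  exists2 A : {fset V}, [set` A] `<=` D & (c < (\sum_(v <- A) a v)%:E)%E.
Proof.
move=> a0; apply: contraPP => h; apply/negP; rewrite -leNgt.
apply: esum_le_fset => // A AD; rewrite leNgt; apply/negP => lt_c.
by apply: h; exists A.
Qed.

End FsetSums.

Lemma powRV (R : realType) (x r : R) : 0 <= x -> x^-1 `^ r = (x `^ r)^-1.
Proof. by move=> x0; rewrite -powR_inv1// -powRrM mulN1r powRN. Qed.

(** Convexity of the [p]-th power at [x / s] and [y / t] with weights proportional to [s] and [t].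
    With bounds of two norms for [s] and [t], summation over the vertices gives Minkowski's
    inequality. *)
Lemma powR_weighted_le (R : realType) (p s t x y : R) :
    1 <= p -> 0 < s -> 0 < t -> 0 <= x -> 0 <= y ->
  (x + y) `^ p <= (s + t) `^ p * (s / (s + t) * (x `^ p / s `^ p) +
                                  t / (s + t) * (y `^ p / t `^ p)).
Proof.
move=> p1 s0 t0 x0 y0; have st0 : 0 < s + t by rewrite addr_gt0.
have w0 : 0 <= s / (s + t) by rewrite divr_ge0 ?ltW.
have w1 : s / (s + t) <= 1 by rewrite ler_pdivrMr// mul1r lerDl ltW.
have := convex_powR p1 (Itv01 w0 w1) (x := x / s) (y := y / t).
rewrite !inE /= !in_itv /= !andbT !divr_ge0 ?(ltW s0) ?(ltW t0)// => /(_ isT isT).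
rewrite !convRE /= /unstable.onem.
rewrite !(powRM _ x0) ?(powRM _ y0) ?invr_ge0 ?(ltW s0) ?(ltW t0)//.
rewrite (powRV _ (ltW s0)) (powRV _ (ltW t0)) => h.
have -> : t / (s + t) = 1 - s / (s + t) by field; rewrite gt_eqF.
apply: le_trans (ler_wpM2l (powR_ge0 _ _) h).
rewrite -powRM ?(ltW st0)//; last first.
  by rewrite addr_ge0// mulr_ge0// ?divr_ge0 ?subr_ge0 ?(ltW s0) ?(ltW t0).
have -> // : (s + t) * (s / (s + t) * (x / s) + (1 - s / (s + t)) * (y / t)) = x + y.
by field; rewrite !gt_eqF.
Qed.

Section FiniteNorms.
Variables (R : realType) (b : scalar_kind) (V : countType).
Local Notation K := (scalar_field R b).
Variables (mu : V -> K) (X : space_kind R).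
Hypothesis hX : admissible X.
Implicit Types (A B F G : {fset V}) (f g : V -> K).

(** The norm of the restriction of [f] to a finite set. Membership and norms are reduced to it,
    which replaces extended-real sums and suprema by finite ones and treats all spaces alike. *)
Definition finnorm A f : R :=
  match X with
  | Ellp p => (\sum_(v <- A) modulus (f v * mu v) `^ p) `^ p^-1
  | C0 => \big[Num.max/0]_(v <- A) modulus (f v * mu v)
  end.

Lemma finnorm_ge0 A f : 0 <= finnorm A f.
Proof.
by rewrite /finnorm; case: X => [p|]; [exact: powR_ge0|exact: bigmax_ge_id].
Qed.

Lemma sum_powR_ge0 (p : R) A f : 0 <= \sum_(v <- A) modulus (f v * mu v) `^ p.
Proof. by apply: sumr_ge0 => v _; exact: powR_ge0. Qed.

Lemma powR_inv_le (p x r : R) : 0 < p -> 0 <= x -> 0 <= r ->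
  (x `^ p^-1 <= r) = (x <= r `^ p).
Proof.
move=> p0 x0 r0; have pn0 : p != 0 by rewrite gt_eqF.
apply/idP/idP => h.
  have := ge0_ler_powR (ltW p0) (_ : _ \is Num.nneg) (_ : _ \is Num.nneg) h.
  by rewrite !nnegrE -powRrM mulVf// powRr1//; apply => //; exact: powR_ge0.
have := ge0_ler_powR (_ : 0 <= p^-1) (_ : _ \is Num.nneg) (_ : _ \is Num.nneg) h.
rewrite !nnegrE -powRrM divff// powRr1//; apply => //; last exact: powR_ge0.
by rewrite invr_ge0 ltW.
Qed.

Lemma finnorm_ellP p A f r : X = Ellp p -> 0 <= r ->
  (finnorm A f <= r) = (\sum_(v <- A) modulus (f v * mu v) `^ p <= r `^ p).
Proof.
move=> XE r0; rewrite /finnorm XE powR_inv_le//; last exact: sum_powR_ge0.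
by move: hX; rewrite XE /=; exact: lt_le_trans.
Qed.

Lemma finnorm_c0P A f r : X = C0 -> 0 <= r ->
  (finnorm A f <= r) <-> (forall v, v \in A -> modulus (f v * mu v) <= r).
Proof.
move=> XE r0; rewrite /finnorm XE; split => h.
  move=> v vA; apply: le_trans h.
  exact: (@le_bigmax_seq _ _ _ _ 0 v xpredT (fun v => modulus (f v * mu v)) vA isT).
by rewrite big_seq; exact: bigmax_le.
Qed.

(** One comparison that serves restriction to a subset, cutting off and termwise domination: the
    function may vanish at the points of [A] outside [B]. *)
Lemma finnorm_mono A B f g :
    (forall v, v \in A -> f v = 0 \/ v \in B /\ modulus (f v) <= modulus (g v)) ->
  finnorm A f <= finnorm B g.
Proof.
move=> h.
have h' v : v \in A -> modulus (f v * mu v) = 0 \/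
    v \in B /\ modulus (f v * mu v) <= modulus (g v * mu v).
  move=> /h[->|[vB le_fg]]; [left|right]; first by rewrite mul0r modulus0.
  by split; rewrite // !modulusM ler_wpM2r ?modulus_ge0.
case XE : X => [p|].
  have p0 : 0 < p by move: hX; rewrite XE; exact: lt_le_trans.
  rewrite (finnorm_ellP _ _ XE (finnorm_ge0 _ _)) [in leRHS]/finnorm XE.
  rewrite -powRrM mulVf ?gt_eqF// powRr1 ?sum_powR_ge0//.
  apply: fsum_le => [v _|v /h'[->|[vB le_fg]]]; first exact: powR_ge0.
    by left; rewrite powR0 ?gt_eqF.
  by right; split=> //; apply: ge0_ler_powR; rewrite ?nnegrE ?modulus_ge0// ltW.
apply/(finnorm_c0P _ _ XE (finnorm_ge0 _ _)) => v /h'[->|[vB le_fg]].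
  exact: finnorm_ge0.
apply: (le_trans le_fg); rewrite /finnorm XE.
exact: (@le_bigmax_seq _ _ _ _ 0 v xpredT (fun v => modulus (g v * mu v)) vB isT).
Qed.

Lemma finnorm_sub A B f : {subset A <= B} -> finnorm A f <= finnorm B f.
Proof. by move=> AB; apply: finnorm_mono => v /AB; right. Qed.

Lemma finnorm1 v f : finnorm [fset v]%fset f = modulus (f v * mu v).
Proof.
case XE : X => [p|].
  rewrite /finnorm XE big_seq_fset1 -powRrM divff ?powRr1 ?modulus_ge0// gt_eqF//.
  by move: hX; rewrite XE => /lt_le_trans->.
apply/le_anti/andP; split.
  by apply/(finnorm_c0P _ _ XE (modulus_ge0 _)) => w; rewrite inE => /eqP->.
by apply: (finnorm_c0P [fset v]%fset f XE (finnorm_ge0 _ _)).1; rewrite ?inE.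
Qed.

Lemma finnorm_coord A v f : v \in A -> modulus (f v * mu v) <= finnorm A f.
Proof.
by move=> vA; rewrite -finnorm1; apply: finnorm_sub => w; rewrite inE => /eqP->.
Qed.

Lemma finnormD A f g : finnorm A (f \+ g) <= finnorm A f + finnorm A g.
Proof.
have ab0 : 0 <= finnorm A f + finnorm A g by rewrite addr_ge0 ?finnorm_ge0.
case XE : X => [p|]; last first.
  apply/(finnorm_c0P _ _ XE ab0) => v vA /=; rewrite mulrDl.
  by apply: le_trans (modulusD _ _) _; rewrite lerD ?finnorm_coord.
have p1 : 1 <= p by move: hX; rewrite XE.
have p0 : 0 < p by exact: lt_le_trans p1.
(* A slack of [e / 2] on each side makes both bounds positive, so that they can serve as the
   divisors [s] and [t]. *)
apply/ler_addgt0Pr => e e0.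
have [s0 t0] : 0 < finnorm A f + e / 2 /\ 0 < finnorm A g + e / 2.
  by split; rewrite ltr_wpDl ?finnorm_ge0// divr_gt0.
have : finnorm A f <= finnorm A f + e / 2 by rewrite lerDl divr_ge0 ?ltW.
have : finnorm A g <= finnorm A g + e / 2 by rewrite lerDl divr_ge0 ?ltW.
have -> : finnorm A f + finnorm A g + e = (finnorm A f + e / 2) + (finnorm A g + e / 2).
  by field.
move: s0 t0; move: (finnorm A f + e / 2) (finnorm A g + e / 2) => s t s0 t0.
rewrite !(finnorm_ellP _ _ XE) ?addr_ge0 ?(ltW s0) ?(ltW t0)// => g_le f_le.
apply: (@le_trans _ _ (\sum_(v <- A) (s + t) `^ p *
    (s / (s + t) * (modulus (f v * mu v) `^ p / s `^ p) +
     t / (s + t) * (modulus (g v * mu v) `^ p / t `^ p)))).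
  apply: ler_sum => v _; apply: le_trans (powR_weighted_le p1 s0 t0 _ _).
  - apply: ge0_ler_powR; rewrite ?nnegrE ?addr_ge0 ?modulus_ge0 ?(ltW p0)//=.
    rewrite mulrDl.
    exact: modulusD.
  - exact: modulus_ge0.
  - exact: modulus_ge0.
rewrite -mulr_sumr ler_piMr ?powR_ge0// big_split /= -!mulr_sumr -!mulr_suml.
have st0 : 0 < s + t by rewrite addr_gt0.
have -> : 1 = s / (s + t) * 1 + t / (s + t) * 1 by field; rewrite gt_eqF.
by apply: lerD; rewrite ler_wpM2l ?divr_ge0 ?(ltW s0) ?(ltW t0) ?(ltW st0)//
  ler_pdivrMr ?powR_gt0// mul1r.
Qed.

Lemma finnormZ A (c : K) f : finnorm A (c \*o f) = modulus c * finnorm A f.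
Proof.
case XE : X => [p|]; rewrite /finnorm XE.
  have p0 : 0 < p by move: hX; rewrite XE; exact: lt_le_trans.
  rewrite (eq_bigr (fun v => modulus c `^ p * modulus (f v * mu v) `^ p)).
    rewrite -mulr_sumr powRM ?powR_ge0 ?sum_powR_ge0// -powRrM divff ?gt_eqF//.
    by rewrite powRr1 ?modulus_ge0.
  by move=> v _ /=; rewrite -mulrA modulusM powRM ?modulus_ge0.
have max_morph : {morph ( *%R (modulus c)) : r s / Num.max r s}.
  by move=> r s; rewrite maxr_pMr ?modulus_ge0.
rewrite (big_morph _ max_morph (mulr0 _)).
by apply: eq_bigr => v _ /=; rewrite -mulrA modulusM.
Qed.

Lemma finnormN A f : finnorm A (\- f) = finnorm A f.
Proof.
by apply/le_anti/andP; split; apply: finnorm_mono => v vA; right; rewrite modulusN.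
Qed.

Lemma finnormB A f g : finnorm A (f \- g) <= finnorm A f + finnorm A g.
Proof. by rewrite -(finnormN A g); exact: (finnormD A f (\- g)). Qed.

Lemma finnorm_sum A (I : Type) (s : seq I) (F : I -> V -> K) :
  finnorm A (fun v => \sum_(i <- s) F i v) <= \sum_(i <- s) finnorm A (F i).
Proof.
elim: s => [|i s IH].
  rewrite big_nil; apply: (@le_trans _ _ (finnorm A (0 \*o (fun=> 0)))).
    by apply: finnorm_mono => v _; left; rewrite big_nil.
  by rewrite finnormZ modulus0 mul0r.
rewrite big_cons.
apply: le_trans (le_trans _ (finnormD A (F i) (fun v => \sum_(j <- s) F j v))) _.
  by apply: finnorm_mono => v vA; right; rewrite big_cons.
by rewrite lerD2l.
Qed.

(** Triangle inequality for [f] split into its single coordinates; it turns coordinatewise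
    convergence into convergence on finite sets. *)
Lemma finnorm_le_sum A f : finnorm A f <= \sum_(v <- A) modulus (f v * mu v).
Proof.
pose F w v := if v == w then f v else 0 : K.
apply: le_trans (le_trans _ (finnorm_sum A (enum_fset A) F)) _.
  apply: finnorm_mono => v vA; right; split=> //.
  rewrite (big_fsetD1 v vA)/= /F eqxx big_seq big1 ?addr0// => w.
  by rewrite !inE eq_sym => /andP[/negbTE->].
apply: ler_sum => w _; rewrite -finnorm1; apply: finnorm_mono => v vA.
by rewrite /F; case: eqVneq => [->|]; [right; rewrite inE|left].
Qed.

(** A Cauchy criterion common to all the spaces: the part of [f] off a suitable finite set has small
    norm. *)
Lemma in_spaceP f : in_space mu X f <->
  forall e, 0 < e -> exists F, forall G, [disjoint F & G]%fset -> finnorm G f <= e.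
Proof.
case XE : X => [p|] /=; last first.
  split=> h e e0.
    have [F hF] := h e e0; exists F => G FG.
    apply/(finnorm_c0P _ _ XE (ltW e0)) => v vG; apply/ltW/hF.
    by apply/negP => vF; move/fdisjointP : FG => /(_ _ vF); rewrite vG.
  have [F hF] := h (e / 2) ltac:(by rewrite divr_gt0); exists F => v vF.
  have := hF [fset v]%fset; rewrite finnorm1 fdisjointX1 => /(_ vF) /le_lt_trans; apply.
  by rewrite ltr_pdivrMr// mulr_natr mulr2n ltrDl.
have p0 : 0 < p by move: hX; rewrite XE; exact: lt_le_trans.
pose a v := modulus (f v * mu v) `^ p.
have a0 v : 0 <= a v by exact: powR_ge0.
split=> [h e e0|h].
  have S0 : (0 <= \esum_(v in [set: V]) (a v)%:E)%E.
    by apply: esum_ge0 => v _; rewrite lee_fin.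
  have fS : \esum_(v in [set: V]) (a v)%:E \is a fin_num.
    by rewrite ge0_fin_numE.
  have ep0 : 0 < e `^ p by exact: powR_gt0.
  (* [F] carries all but [e ^ p] of the total, so a disjoint [G] carrying more than [e ^ p] would
     push the sum over the union above the total. *)
  have [|F _ hF] := @lt_esum_fset _ _ [set: V] a
    (\esum_(v in [set: V]) (a v)%:E - (e `^ p)%:E)%E a0.
    by rewrite lteBlDr// lteDl.
  exists F => G FG; rewrite (finnorm_ellP _ _ XE (ltW e0)) leNgt; apply/negP => hG.
  have := fset_le_esum (A := (F `|` G)%fset) a0 (@subsetT _ _).
  rewrite fsumU//; move: hF; rewrite -(fineK fS) -EFinB lte_fin lee_fin.
  by move: hG; rewrite -/a; lra.
(* The tail bound 1 is enough: every finite sum is then at most the sum over [F] plus 1. *)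
have [F hF] := h 1 ltr01.
apply: le_lt_trans (ltry (\sum_(v <- F) a v + 1)).
apply: esum_le_fset => // A _; rewrite lee_fin.
have -> : \sum_(v <- A) a v =
    \sum_(v <- (A `&` F)%fset) a v + \sum_(v <- (A `\` F)%fset) a v.
  rewrite -fsumU ?fsetID//; apply/fdisjointP => v.
  by rewrite !inE => /andP[_ ->].
apply: lerD; first by apply: fsum_le => // v; rewrite inE => /andP[_ vF]; right.
have := hF (A `\` F)%fset; rewrite (finnorm_ellP _ _ XE ler01) powR1; apply.
by apply/fdisjointP => v vF; rewrite !inE vF.
Qed.

(** The norm is the supremum of the norms on finite sets. Membership of [f] is what gives [fine] and
    [sup] their meaning, since both return 0 on infinite or unbounded data. *)
Lemma space_normP f r : in_space mu X f -> 0 <= r ->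
  space_norm mu X f <= r <-> forall F, finnorm F f <= r.
Proof.
move=> fX r0; move: (fX); rewrite /space_norm; case XE : X => [p|] /= fp.
  have p0 : 0 < p by move: hX; rewrite XE; exact: lt_le_trans.
  pose a v := modulus (f v * mu v) `^ p.
  have a0 v : 0 <= a v by exact: powR_ge0.
  have S0 : (0 <= \esum_(v in [set: V]) (a v)%:E)%E.
    by apply: esum_ge0 => v _; rewrite lee_fin.
  have fS : \esum_(v in [set: V]) (a v)%:E \is a fin_num.
    by rewrite ge0_fin_numE.
  rewrite powR_inv_le ?fine_ge0// -lee_fin fineK//; split=> h.
    move=> F; rewrite (finnorm_ellP _ _ XE r0) -lee_fin.
    exact: le_trans (fset_le_esum a0 _) h.
  by apply: esum_le_fset => // A _; rewrite lee_fin -(finnorm_ellP _ _ XE r0).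
have [F1 hF1] := (in_spaceP f).1 fX 1 ltr01.
have ubf : has_ubound [set modulus (f v * mu v) | v in [set: V]].
  exists (finnorm F1 f + 1) => _ [v _ <-].
  have [vF|vF] := boolP (v \in F1).
    by apply: le_trans (finnorm_coord _ vF) _; rewrite lerDl.
  have := hF1 [fset v]%fset; rewrite finnorm1 fdisjointX1 => /(_ vF) /le_trans; apply.
  by rewrite lerDr finnorm_ge0.
split=> h.
  move=> F; apply/(finnorm_c0P _ _ XE r0) => v _; apply: le_trans h.
  by apply: ub_le_sup => //; exists v.
have [/eqP->|/set0P S0] := boolP ([set modulus (f v * mu v) | v in [set: V]] == set0).
  by rewrite sup0.
by apply: ge_sup => // _ [v _ <-]; rewrite -finnorm1.
Qed.

End FiniteNorms.

(** * The weighted sequence spaces *)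

Section SpaceNorm.
Variables (R : realType) (b : scalar_kind) (V : countType).
Local Notation K := (scalar_field R b).
Variables (mu : V -> K) (X : space_kind R).
Hypothesis hX : admissible X.
Implicit Types (A B F G : {fset V}) (f g : V -> K).
Local Notation inX := (in_space mu X).
Local Notation normX := (space_norm mu X).
Local Notation finnormX := (finnorm mu X).

Definition supported f A := forall v, v \notin A -> f v = 0.

Definition cutoff A f : V -> K := fun v => if v \in A then f v else 0.

Lemma cutoff_supported A f : supported (cutoff A f) A.
Proof. by move=> v /negbTE vA; rewrite /cutoff vA. Qed.

Lemma finnorm_eq0 A f : (forall v, v \in A -> f v = 0) -> finnormX A f = 0.
Proof.
move=> f0; apply/le_anti; rewrite finnorm_ge0 andbT.
have -> : 0 = finnormX A (0 \*o f) by rewrite finnormZ// modulus0 mul0r.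
by apply: finnorm_mono => // v /f0; left.
Qed.

Lemma in_space_supported A f : supported f A -> inX f.
Proof.
move=> fA; apply/(in_spaceP _ hX) => e e0; exists A => G /fdisjointP AG.
rewrite finnorm_eq0 ?ltW// => v vG; apply: fA.
by apply: contraL vG => /AG.
Qed.

(** Closedness of the space, stated with finite norms because the norm of [f \- g] means nothing
    before [f] is known to be in the space. *)
Lemma in_space_near f :
  (forall e, 0 < e -> exists2 g, inX g & forall F, finnormX F (f \- g) <= e) -> inX f.
Proof.
move=> h; apply/(in_spaceP _ hX) => e e0.
have e20 : 0 < e / 2 by rewrite divr_gt0.
have [g /(in_spaceP _ hX) gX fg] := h _ e20.
have [F hF] := gX _ e20; exists F => G /hF gG.
have -> : f = (f \- g) \+ g by apply/funext => v /=; rewrite subrK.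
by apply: le_trans (finnormD mu hX _ _ _) _; have := fg G; lra.
Qed.

Lemma in_spaceZ (c : K) f : inX f -> inX (c \*o f).
Proof.
move=> /(in_spaceP _ hX) fX; apply/(in_spaceP _ hX) => e e0.
(* The summand 1 keeps the divisor positive when [c] is 0; the same device recurs below. *)
have c0 : 0 < modulus c + 1 by rewrite ltr_wpDl ?modulus_ge0.
have [F hF] := fX _ (divr_gt0 e0 c0); exists F => G /hF.
rewrite ler_pdivlMr// => h; rewrite finnormZ//; apply: le_trans h.
by rewrite mulrC ler_wpM2l ?finnorm_ge0// lerDl.
Qed.

Lemma in_spaceB f g : inX f -> inX g -> inX (f \- g).
Proof.
move=> /(in_spaceP _ hX) fX /(in_spaceP _ hX) gX; apply/(in_spaceP _ hX) => e e0.
have e20 : 0 < e / 2 by rewrite divr_gt0.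
have [F hF] := fX _ e20; have [G hG] := gX _ e20.
exists (F `|` G)%fset => H; rewrite fdisjointUX => /andP[/hF fH /hG gH].
by apply: le_trans (finnormB mu hX _ _ _) _; lra.
Qed.

Lemma in_spaceD f g : inX f -> inX g -> inX (f \+ g).
Proof.
move=> fX gX; have := in_spaceB fX (in_spaceZ (-1) gX).
suff -> : f \- (-1) \*o g = f \+ g by [].
by apply/funext => v /=; rewrite mulN1r opprK.
Qed.

Lemma space_norm_ge0 f : 0 <= normX f.
Proof.
rewrite /space_norm; case: X => [p|]; first exact: powR_ge0.
have [S|/sup_out ->] := pselect (has_sup [set modulus (f v * mu v) | v in [set: V]]);
  last by [].
have [[_ [v _ _]] ubS] := S; apply: le_trans (modulus_ge0 (f v * mu v)) _.
by apply: ub_le_sup => //; exists v.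
Qed.

Lemma finnorm_le_norm F f : inX f -> finnormX F f <= normX f.
Proof.
by move=> fX; apply: ((space_normP hX fX (space_norm_ge0 _)).1 (lexx _)).
Qed.

Lemma space_norm_le r f : inX f -> 0 <= r -> (forall F, finnormX F f <= r) ->
  normX f <= r.
Proof. by move=> fX r0 h; apply/(space_normP hX). Qed.

Lemma norm_coord f v : inX f -> modulus (f v) * modulus (mu v) <= normX f.
Proof. by move=> fX; rewrite -modulusM -(finnorm1 mu hX); exact: finnorm_le_norm. Qed.

Lemma norm_supported A f : supported f A -> normX f = finnormX A f.
Proof.
move=> fA; have fX := in_space_supported fA.
apply/le_anti; rewrite finnorm_le_norm// andbT.
apply: space_norm_le; rewrite ?finnorm_ge0// => G; apply: finnorm_mono => // v vG.
by have [vA|/fA] := boolP (v \in A); [right|left].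
Qed.

Lemma in_space0 : inX (fun=> 0).
Proof. exact: (@in_space_supported fset0). Qed.

Lemma space_norm0 : normX (fun=> 0) = 0.
Proof. by rewrite (@norm_supported fset0) ?finnorm_eq0// => v. Qed.

Lemma space_normD f g : inX f -> inX g -> normX (f \+ g) <= normX f + normX g.
Proof.
move=> fX gX; apply: space_norm_le; rewrite ?addr_ge0 ?space_norm_ge0//.
  exact: in_spaceD.
by move=> F; apply: le_trans (finnormD mu hX _ _ _) _; rewrite lerD ?finnorm_le_norm.
Qed.

Lemma space_normZ (c : K) f : inX f -> normX (c \*o f) <= modulus c * normX f.
Proof.
move=> fX; apply: space_norm_le; rewrite ?mulr_ge0 ?modulus_ge0 ?space_norm_ge0//.
  exact: in_spaceZ.
by move=> F; rewrite finnormZ// ler_wpM2l ?modulus_ge0 ?finnorm_le_norm.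
Qed.

Lemma space_norm_distC f g : normX (f \- g) = normX (g \- f).
Proof.
have E v : modulus ((f \- g) v * mu v) = modulus ((g \- f) v * mu v).
  by rewrite !modulusM /= modulusB.
rewrite /space_norm; case: X => [p|].
  by congr (fine _ `^ _); apply: eq_esum => v _; rewrite E.
by congr sup; apply: eq_imagel => v _; rewrite E.
Qed.

Lemma space_norm_tri g f h : inX f -> inX g -> inX h ->
  normX (f \- h) <= normX (f \- g) + normX (g \- h).
Proof.
move=> fX gX hX'; have -> : f \- h = (f \- g) \+ (g \- h).
  by apply/funext => v /=; rewrite addrA subrK.
by apply: space_normD; exact: in_spaceB.
Qed.

(** Density of the finitely supported vectors: the difference vanishes on [G], and off [F] every
    finite norm of [f] is at most [e]. *)
Lemma cutoff_approx f e : inX f -> 0 < e ->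
  exists F, forall G, {subset F <= G} -> normX (f \- cutoff G f) <= e.
Proof.
move=> fX e0; have [F hF] := (in_spaceP mu hX f).1 fX e e0; exists F => G FG.
have rX : inX (cutoff G f) := in_space_supported (@cutoff_supported G f).
apply: space_norm_le; rewrite ?(ltW e0)//; first exact: in_spaceB.
move=> H; apply: le_trans (hF (H `\` F)%fset _).
  apply: finnorm_mono => // v vH; rewrite !inE vH andbT /= /cutoff.
  have [vG|vG] := boolP (v \in G); first by left; rewrite subrr.
  by right; rewrite subr0; split=> //; apply: contra vG; exact: FG.
by apply/fdisjointP => v vF; rewrite !inE vF.
Qed.

End SpaceNorm.

(** * Unordered sums of scalars *)

Section HasSum.
Variables (R : realType) (b : scalar_kind) (V : countType).
Local Notation K := (scalar_field R b).
Implicit Types (D : set V) (f g : V -> K) (s t : K) (A : {fset V}).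

Lemma has_sum_unique D f s t : has_sum D f s -> has_sum D f t -> s = t.
Proof.
move=> hs ht; apply/eqP; rewrite -subr_eq0 -modulus_eq0; apply/eqP/le_anti.
rewrite modulus_ge0 andbT; apply/ler_addgt0Pr => e e0; rewrite add0r.
have e20 : 0 < e / 2 by rewrite divr_gt0.
have [A AD hA] := hs _ e20; have [B BD hB] := ht _ e20.
have UD : [set` (A `|` B)%fset] `<=` D.
  by move=> v /=; rewrite in_fsetU => /orP[/AD|/BD].
have := hA _ UD; have := hB _ UD.
move=> /(_ _)/wrap[|h1 /(_ _)/wrap[|h2]].
- by move=> v /= vB; rewrite in_fsetU vB orbT.
- by move=> v /= vA; rewrite in_fsetU vA.
apply: le_trans (modulusB_tri _ (\sum_(u <- (A `|` B)%fset) f u) _) _.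
by rewrite modulusB; lra.
Qed.

Lemma unordered_sumE D f s : has_sum D f s -> unordered_sum D f = s.
Proof. by move=> hs; apply: (has_sum_unique _ hs); exact: xgetPex (ex_intro _ s hs). Qed.

Lemma has_sumB D f g s t : has_sum D f s -> has_sum D g t -> has_sum D (f \- g) (s - t).
Proof.
move=> hs ht e e0; have e20 : 0 < e / 2 by rewrite divr_gt0.
have [A AD hA] := hs _ e20; have [B BD hB] := ht _ e20.
exists (A `|` B)%fset; first by move=> v /=; rewrite in_fsetU => /orP[/AD|/BD].
move=> C CD UC.
have AC : modulus (\sum_(u <- C) f u - s) < e / 2.
  by apply: hA => // v vA; apply: UC; rewrite /= in_fsetU vA.
have BC : modulus (\sum_(u <- C) g u - t) < e / 2.
  by apply: hB => // v vB; apply: UC; rewrite /= in_fsetU vB orbT.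
rewrite sumrB.
have -> : \sum_(u <- C) f u - \sum_(u <- C) g u - (s - t) =
    (\sum_(u <- C) f u - s) - (\sum_(u <- C) g u - t) by ring.
by apply: le_lt_trans (modulusD _ _) _; rewrite modulusN; lra.
Qed.

Lemma has_sumZ D (c : K) f s : has_sum D f s -> has_sum D (c \*o f) (c * s).
Proof.
move=> hs e e0; have c0 : 0 < modulus c + 1 by rewrite ltr_wpDl ?modulus_ge0.
have [A AD hA] := hs _ (divr_gt0 e0 c0); exists A => // C CD AC.
have := hA _ CD AC; rewrite ltr_pdivlMr// => h.
rewrite -mulr_sumr -mulrBr modulusM; apply: le_lt_trans h.
by rewrite mulrC ler_wpM2l ?modulus_ge0// lerDl.
Qed.

Lemma has_sum_supported D f A : supported f A ->
  has_sum D f (\sum_(u <- A | u \in D) f u).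
Proof.
move=> fA e e0; pose AD := [fset u in A | u \in D]%fset.
exists AD; first by move=> v /=; rewrite !inE /= => /andP[_]; rewrite inE.
move=> C CD AC; rewrite (_ : \sum_(u <- C) f u = \sum_(u <- A | u \in D) f u).
  by rewrite subrr modulus0.
rewrite [RHS]big_fset_condE -/AD.
apply/esym/big_fset_incl; first by apply/fsubsetP => v /AC.
move=> v vC; rewrite !inE /= negb_and => /orP[/fA//|/negP[]].
by rewrite inE; exact: CD.
Qed.

End HasSum.

(** * The tree and its backward shift *)

Lemma seq_eventually (T : eqType) (s : seq T) (P : T -> nat -> Prop) :
  (forall x, x \in s -> exists N, forall n, (N <= n)%N -> P x n) ->
  exists N, forall n, (N <= n)%N -> forall x, x \in s -> P x n.
Proof.
elim: s => [|x s IH] h; first by exists 0%N.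
have [N hN] := IH (fun y ys => h y (mem_behead (s := x :: s) ys)).
have [M hM] := h x (mem_head _ _).
exists (maxn N M) => n; rewrite geq_max => /andP[Nn Mn] y.
by rewrite inE => /orP[/eqP->|]; [exact: hM|exact: hN].
Qed.

Section Tree.
Variables (V : countType) (E : rel V).
Hypotheses (htree : directed_tree E) (hunrooted : unrooted E).
Implicit Types u v w : V.
Local Notation par := (par E).

(** Without roots the dummy value of [par] never occurs, and parents are unique. *)
Lemma parP u v : E u v <-> par v = u.
Proof.
have Epar : E (par v) v.
  have [u' Eu'] : exists u', E u' v.
    by apply: contrapT => h; apply: hunrooted; exists v.
  exact: (xgetPex v (ex_intro [set u | E u v] u' Eu')).
by split=> [Euv|<-] //; exact: tree_parent_unique htree _ _ _ Epar Euv.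
Qed.

Lemma ChinP n v u : Chin E n v u <-> iter n par u = v.
Proof.
elim: n v => [|n IH] v //=; split.
  by move=> [w /parP <- /IH ->].
by move=> parv; exists (iter n par u); [apply/parP|apply/IH].
Qed.

(** A shortest loop of ancestors has distinct vertices and hence is a circuit; length one is
    excluded by irreflexivity instead. *)
Lemma iter_par_neq n v : iter n.+1 par v <> v.
Proof.
move=> loopv; have ex_loop : exists k, iter k.+1 par v == v by exists n; apply/eqP.
case: (ex_minnP ex_loop) => {loopv ex_loop}n /eqP loopv minn.
have uniq_s : uniq (traject par v n.+1).
  apply/(uniqP v) => i j; rewrite !inE !size_traject => lt_i lt_j.
  rewrite !nth_traject//.
  (* If two iterates agreed, the stretch between them could be cut out, leaving a shorter loop at
     [v]. *)
  have cancel a c : (a < c)%N -> (c <= n)%N -> iter a par v <> iter c par v.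
    move=> ac cn eq_ac; have := minn (n - c + a)%N.
    have -> : (n - c + a).+1 = ((n.+1 - c) + a)%N by rewrite subSn// addSn.
    rewrite iterD eq_ac -iterD subnK ?(leq_trans cn)// loopv eqxx => /(_ isT).
    by rewrite leqNgt -{2}(subnK cn) ltn_add2l ac.
  by move=> eq_ij; case: (ltngtP i j) => // [/cancel|/cancel] h; case: (h _).
case: n loopv minn uniq_s => [/= /parP Evv _ _|n loopv _ uniq_s].
  by have := tree_irreflexive htree v; rewrite Evv.
(* Edges run from parent to child, against the iteration of [par], so the trajectory has to be
   reversed. *)
have := tree_acyclic htree (s := rev (traject par v n.+2)).
rewrite size_rev size_traject rev_uniq uniq_s rev_cycle => /(_ isT isT) /negP; apply.
change (path (fun x y => E y x) v (rcons (traject par (par v) n.+1) v)).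
have -> : rcons (traject par (par v) n.+1) v = traject par (par v) n.+2.
  by rewrite [RHS]trajectSr -iterSr loopv.
apply: sub_path (fpath_traject par v n.+2) => x y /=.
by move=> /eqP /parP.
Qed.

Lemma iter_par_inj n m v : iter n par v = iter m par v -> n = m.
Proof.
wlog le_nm : n m / (n <= m)%N.
  by move=> h; case: (leqP n m) => [|/ltnW] /h // h' /esym/h' ->.
move: le_nm; rewrite leq_eqVlt => /orP[/eqP//|/subnK <-].
by rewrite -addSnnS iterD => /esym/iter_par_neq.
Qed.

(** By injectivity of [n] to the [n]-th ancestor, a vertex [w] is the [n]-th ancestor of [v] for at
    most one [n], and there are finitely many pairs to avoid. *)
Lemma iter_par_avoid (A : {fset V}) :
  exists N, forall n, (N <= n)%N -> forall v, v \in A -> iter n par v \notin A.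
Proof.
apply: seq_eventually => v vA.
have [N hN] : exists N, forall n, (N <= n)%N -> forall w, w \in enum_fset A ->
    iter n par v <> w.
  apply: seq_eventually => w wA.
  have [[m mw]|h] := pselect (exists m, iter m par v = w); last first.
    by exists 0%N => n _ nw; apply: h; exists n.
  exists m.+1 => n mn nw; move: mn.
  by rewrite (@iter_par_inj n m v) ?ltnn// nw mw.
by exists N => n /hN h; apply/negP => /h.
Qed.

End Tree.

(** * Linearity and boundedness of the iterated shift, and its action on finitely supported
    vectors *)

Section Shift.
Variables (R : realType) (b : scalar_kind) (V : countType) (E : rel V).
Local Notation K := (scalar_field R b).
Variables (mu : V -> K) (X : space_kind R).
Hypotheses (hX : admissible X) (hB : bounded_backward_shift E mu X).
Implicit Types (A : {fset V}) (f g : V -> K).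
Local Notation inX := (in_space mu X).
Local Notation normX := (space_norm mu X).
Local Notation T := (@backward_shift R b V E).

Lemma shiftE f v : inX f -> has_sum (Chi E v) f (T f v).
Proof.
by move=> fX; exact: (xgetPex 0 (shift_defined hB fX v)).
Qed.

Lemma in_space_iter_shift n f : inX f -> inX (iter n T f).
Proof. by move=> fX; elim: n => //= n IH; exact: shift_stable hB _ IH. Qed.

Lemma iter_shiftB n f g : inX f -> inX g ->
  iter n T (f \- g) = iter n T f \- iter n T g.
Proof.
move=> fX gX; elim: n => //= n ->; apply/funext => v.
by apply: unordered_sumE; apply: has_sumB; apply: shiftE; exact: in_space_iter_shift.
Qed.

Lemma iter_shiftZ n (c : K) f : inX f -> iter n T (c \*o f) = c \*o iter n T f.
Proof.
move=> fX; elim: n => //= n ->; apply/funext => v.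
by apply: unordered_sumE; apply: has_sumZ; apply: shiftE; exact: in_space_iter_shift.
Qed.

Lemma iter_shiftD n f g : inX f -> inX g ->
  iter n T (f \+ g) = iter n T f \+ iter n T g.
Proof.
move=> fX gX; have gX' := in_spaceZ hX (-1) gX.
have -> : f \+ g = f \- (-1) \*o g by apply/funext => v /=; rewrite mulN1r opprK.
rewrite iter_shiftB// iter_shiftZ//.
by apply/funext => v /=; rewrite mulN1r opprK.
Qed.

Lemma iter_shift_bounded n :
  exists2 C : R, 0 < C & forall f, inX f -> normX (iter n T f) <= C * normX f.
Proof.
(* The given bound [C] may be zero or negative; a positive one can be divided by later. *)
have [C hC] := shift_bounded hB; have C0 : 0 < `|C| + 1 by rewrite ltr_wpDl.
exists ((`|C| + 1) ^+ n); first exact: exprn_gt0.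
move=> f fX; elim: n => [|n IH]; first by rewrite expr0 mul1r.
apply: le_trans (hC _ (in_space_iter_shift n fX)) _.
rewrite exprS -mulrA; apply: le_trans (ler_wpM2l (ltW C0) IH).
rewrite ler_wpM2r ?space_norm_ge0//.
by apply: le_trans (ler_norm C) _; rewrite lerDl.
Qed.

Hypotheses (htree : directed_tree E) (hunrooted : unrooted E).

(** The [n]-th iterate is supported on the [n]-th ancestors of [A], so the next shift is again a
    finite sum; exchanging the two sums groups the vertices of [A] by their ancestor. *)
Lemma iter_shift_supported n f A v : supported f A ->
  iter n T f v = \sum_(u <- A | iter n (par E) u == v) f u.
Proof.
move=> fA; elim: n v => [|n IH] v /=.
  rewrite -big_filter; have [vA|/[dup] vA /fA->] := boolP (v \in A).
    rewrite (_ : [seq u <- A | u == v] = [:: v]) ?big_seq1//.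
    by rewrite -(filter_pred1_uniq (fset_uniq A) vA); apply: eq_filter => u.
  rewrite big_filter big_seq_cond big1// => u /andP[uA /eqP uv].
  by rewrite -uv uA in vA.
pose B := [fset iter n (par E) u | u in A]%fset.
have TB : supported (iter n T f) B.
  move=> w wB; rewrite (IH w) big_seq_cond big1// => u /andP[uA /eqP uw].
  by move: wB; rewrite -uw in_imfset.
rewrite /backward_shift (unordered_sumE (has_sum_supported (Chi E v) TB)).
rewrite (eq_bigr _ (fun w _ => IH w)).
rewrite (exchange_big_dep (fun u => par E (iter n (par E) u) == v))/=; last first.
  by move=> w u; rewrite inE => /(parP htree hunrooted) wv /eqP->; apply/eqP.
rewrite big_seq_cond [RHS]big_seq_cond; apply: eq_bigr => u /andP[uA /eqP uv].
rewrite -big_filter.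
rewrite (_ : [seq w <- B | _] = [:: iter n (par E) u]) ?big_seq1//.
rewrite -(filter_pred1_uniq (fset_uniq B) (_ : iter n (par E) u \in B)) ?in_imfset//.
apply: eq_filter => w /=; rewrite [_ == w]eq_sym; have [->|] := eqVneq w; rewrite ?andbF ?andbT//.
by apply/idP; rewrite inE; apply/(parP htree hunrooted).
Qed.

End Shift.

(** * Thin sets and duality *)

Section Thin.
Variables (R : realType) (b : scalar_kind) (V : countType).
Local Notation K := (scalar_field R b).
Variable X : space_kind R.
Hypothesis hX : admissible X.
Implicit Types (mu : V -> K) (A : {fset V}) (f g : V -> K) (D : set V) (e : R).

Definition thin mu D e := exists A g,
  [/\ [set` A] `<=` D, supported g A, \sum_(u <- A) g u = 1 & finnorm mu X A g <= e].

(** Dividing [f] by its sum over [A] normalises the sum to 1 and multiplies the norm by at most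
    [c^-1]. *)
Lemma thin_sum mu D e c A f : [set` A] `<=` D -> 0 < c ->
  c <= modulus (\sum_(u <- A) f u) -> finnorm mu X A f <= e * c -> thin mu D e.
Proof.
move=> AD c0 cs fe; set s := \sum_(u <- A) f u in cs.
have s0 : s != 0 by rewrite -modulus_gt0; exact: lt_le_trans cs.
exists A, (cutoff A (s^-1 \*o f)); split=> //; first exact: cutoff_supported.
  rewrite big_seq (eq_bigr (fun u => s^-1 * f u)); last first.
    by move=> u uA; rewrite /cutoff uA.
  by rewrite -big_seq -mulr_sumr mulVf.
apply: (@le_trans _ _ (finnorm mu X A (s^-1 \*o f))).
  by apply: finnorm_mono => // u uA; right; rewrite /cutoff uA.
rewrite finnormZ// modulusV mulrC ler_pdivrMr ?modulus_gt0//.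
have e0 : 0 <= e.
  by rewrite -(pmulr_lge0 e c0); exact: le_trans (finnorm_ge0 _ _ _ _) fe.
by apply: le_trans fe _; rewrite ler_wpM2l.
Qed.

Lemma thin_sum_modulus mu D e : thin mu D e -> exists A g, [/\ [set` A] `<=` D,
  1 <= \sum_(u <- A) modulus (g u) & finnorm mu X A g <= e].
Proof.
move=> [A [g [AD _ sg ge]]]; exists A, g; split=> //.
by rewrite -(modulus1 R b) -sg; exact: modulus_sum.
Qed.

Lemma thin_le mu D e e' : e <= e' -> thin mu D e -> thin mu D e'.
Proof. by move=> ee' [A [g [? ? ? /le_trans/(_ ee')]]]; exists A, g. Qed.

(** Dividing the weight by [l] divides every norm by the modulus of [l]; this absorbs the scalars of
    the first condition into the weight. *)
Lemma thinZ mu D e (l : K) : l != 0 ->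
  thin (fun u => mu u / l) D e <-> thin mu D (e * modulus l).
Proof.
move=> l0; have l0' : 0 < modulus l by rewrite modulus_gt0.
have E A g : finnorm (fun u => mu u / l) X A g <= e = (finnorm mu X A g <= e * modulus l).
  rewrite -ler_pdivrMr// mulrC -modulusV -finnormZ//; congr (_ <= e).
  have E u : g u * (mu u / l) = l^-1 * g u * mu u by rewrite mulrA mulrC mulrA.
  by rewrite /finnorm; case: X => [p|]; [congr (_ `^ _)|];
    apply: eq_bigr => u _ /=; rewrite E.
by split=> -[A [g [AD gA sg ge]]]; exists A, g; split=> //; move: ge; rewrite E.
Qed.

(** Duality in the form used below: [D] is [e]-thin essentially when the inverse weights have dual
    norm at least [e^-1] on [D]. It covers [c_0] with [q = 1] and [l^p] for [p > 1]; the strict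
    inequality in the converse allows passing to a finite subset of [D]. *)
Definition dual_exponent (q : R) :=
  [/\ 0 < q,
   forall mu D e, (forall v, mu v != 0) -> 0 < e -> thin mu D e ->
     ((e `^ q)^-1%:E <= \esum_(u in D) (modulus (mu u) `^ q)^-1%:E)%E &
   forall mu D e, (forall v, mu v != 0) -> 0 < e ->
     ((e `^ q)^-1%:E < \esum_(u in D) (modulus (mu u) `^ q)^-1%:E)%E -> thin mu D e].

Lemma invr_powR_ge0 (x q : R) : 0 <= (x `^ q)^-1.
Proof. by rewrite invr_ge0 powR_ge0. Qed.

Lemma dual_exponent_c0 : X = C0 -> dual_exponent 1.
Proof.
move=> XE; split=> // mu D e mu0 e0; rewrite powRr1 ?(ltW e0)//.
  move=> /thin_sum_modulus[A [g [AD sg ge]]].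
  apply: le_trans (fset_le_esum (fun u => invr_powR_ge0 _ _) AD).
  rewrite lee_fin -[leLHS]mul1r ler_pdivrMr// (le_trans sg)//.
  rewrite mulr_suml big_seq [leRHS]big_seq ler_sum// => u uA.
  rewrite powRr1 ?modulus_ge0// mulrC ler_pdivlMr ?modulus_gt0//.
  by rewrite -modulusM; apply: ((finnorm_c0P mu _ _ XE (ltW e0)).1 ge).
have w0 u := invr_powR_ge0 (modulus (mu u)) 1.
move=> /(lt_esum_fset w0) [A AD]; rewrite lte_fin => eS.
set S := \sum_(u <- A) (modulus (mu u) `^ 1)^-1 in eS.
have S0 : 0 < S by apply: lt_trans eS; rewrite invr_gt0.
(* Coefficients proportional to the inverse weights make all weighted coordinates equal to [S^-1] in
   modulus, which is below [e]. *)
apply: (@thin_sum mu D e 1 A (fun u => of_real b ((modulus (mu u) `^ 1)^-1 / S))) => //.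
  by rewrite -of_real_sum -mulr_suml divff ?gt_eqF// of_real1 modulus1.
rewrite mulr1; apply/(finnorm_c0P mu _ _ XE (ltW e0)) => u uA.
rewrite modulusM modulus_of_real ger0_norm ?divr_ge0 ?(ltW S0)// powRr1 ?modulus_ge0//.
rewrite mulrAC mulVf ?modulus_eq0// mul1r.
by rewrite -[e]invrK lef_pV2 ?posrE ?invr_gt0// ltW.
Qed.

Lemma conj_exponentP (p : R) : 1 < p ->
  0 < conj_exponent p /\ p^-1 + (conj_exponent p)^-1 = 1.
Proof.
move=> p1; have p10 : 0 < p - 1 by rewrite subr_gt0.
split; first by rewrite divr_gt0// (lt_trans ltr01).
by rewrite /conj_exponent; field; rewrite !gt_eqF// (lt_trans ltr01).
Qed.

Lemma dual_exponent_ell p : X = Ellp p -> 1 < p -> dual_exponent (conj_exponent p).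
Proof.
move=> XE p1; have [q0 pq1] := conj_exponentP p1; set q := conj_exponent p in q0 pq1 *.
have p0 : 0 < p by exact: lt_trans p1.
split=> // mu D e mu0 e0; have w0 u := invr_powR_ge0 (modulus (mu u)) q.
  move=> /thin_sum_modulus[A [g [AD sg ge]]].
  apply: le_trans (fset_le_esum w0 AD).
  move: ge; rewrite lee_fin (finnorm_ellP mu hX _ _ XE (ltW e0)) => ge.
  set S := \sum_(u <- A) (modulus (mu u) `^ q)^-1.
  have eq0 : 0 < e `^ q by exact: powR_gt0.
  have ep0 : 0 < e `^ p by exact: powR_gt0.
  (* Young's inequality for the product of |g mu| / e and e / |mu|. Summed over [A], the first terms
     give at most [p^-1], so the second ones give at least [q^-1]. *)
  have young u : modulus (g u) <= modulus (g u * mu u) `^ p / (e `^ p * p) +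
      (modulus (mu u) `^ q)^-1 * (e `^ q / q).
    have m0 : 0 < modulus (mu u) by rewrite modulus_gt0.
    have := @conjugate_powR R (modulus (g u * mu u) / e) (e / modulus (mu u)) p q.
    rewrite !divr_ge0 ?modulus_ge0 ?(ltW e0)// => /(_ isT isT p0 q0 pq1).
    rewrite !powRM ?modulus_ge0 ?invr_ge0 ?(ltW e0) ?(ltW m0)//.
    rewrite (powRV _ (ltW e0)) (powRV _ (ltW m0)).
    have -> : modulus (g u * mu u) / e * (e / modulus (mu u)) = modulus (g u).
      by rewrite modulusM; field; rewrite !gt_eqF.
    have mq0 : 0 < modulus (mu u) `^ q by exact: powR_gt0.
    move/le_trans; apply; rewrite le_eqVlt; apply/orP; left; apply/eqP.
    by field; rewrite !gt_eqF.
  have := le_trans sg (ler_sum _ (fun u _ => young u)).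
  rewrite big_split /= -!mulr_suml -/S => h.
  have {}h : 1 <= p^-1 + S * (e `^ q / q).
    apply: le_trans h _; rewrite lerD2r ler_pdivrMr ?mulr_gt0//.
    by rewrite mulrCA mulVf ?gt_eqF// mulr1.
  move: h; rewrite -pq1 lerD2l mulrA ler_pdivlMr// mulVf ?gt_eqF//.
  by rewrite -ler_pdivrMr// mul1r.
move=> /(lt_esum_fset w0) [A AD]; rewrite lte_fin => eS.
set S := \sum_(u <- A) (modulus (mu u) `^ q)^-1 in eS.
have S0 : 0 < S by apply: lt_trans eS; rewrite invr_gt0 powR_gt0.
(* The case of equality in Hoelder's inequality: since [(1 - q) * p = - q], the [p]-th power of the
   norm is [S] to the power [1 - p], and [q * (p - 1) = p] bounds this by [e ^ p]. *)
apply: (@thin_sum mu D e 1 A (fun u => of_real b ((modulus (mu u) `^ q)^-1 / S))) => //.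
  by rewrite -of_real_sum -mulr_suml divff ?gt_eqF// of_real1 modulus1.
rewrite mulr1 (finnorm_ellP mu hX _ _ XE (ltW e0)).
have qp : q * (p - 1) = p by rewrite /q /conj_exponent divfK// subr_eq0 gt_eqF.
rewrite (eq_bigr (fun u => (modulus (mu u) `^ q)^-1 * S^-1 `^ p)); last first.
  move=> u _; have m0 : 0 < modulus (mu u) by rewrite modulus_gt0.
  rewrite modulusM modulus_of_real ger0_norm ?divr_ge0 ?(ltW S0)//.
  rewrite mulrAC powRM ?invr_ge0 ?(ltW S0) ?mulr_ge0 ?(ltW m0)//; congr (_ * _).
  have -> : (modulus (mu u) `^ q)^-1 * modulus (mu u) = modulus (mu u) `^ (1 - q).
    rewrite (@powRB _ _ 1 q); last by rewrite (gt_eqF m0) implybT.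
    by rewrite powRr1 ?(ltW m0)// mulrC.
  rewrite -powRrM -powRN; congr (_ `^ _).
  by move: qp; rewrite mulrBr mulr1 mulrBl mul1r; lra.
rewrite -mulr_suml -/S.
have -> : S * S^-1 `^ p = S^-1 `^ (p - 1).
  have SE : S = S^-1 `^ (-1) by rewrite powR_inv1 ?invr_ge0 ?(ltW S0)// invrK.
  have Sp : (-1 + p == 0) ==> (S^-1 != 0) by rewrite invr_eq0 (gt_eqF S0) implybT.
  by rewrite {1}SE -(powRD Sp) addrC.
rewrite -{2}qp powRrM; apply: ge0_ler_powR.
- by rewrite subr_ge0 ltW.
- by rewrite nnegrE invr_ge0 ltW.
- by rewrite nnegrE powR_ge0.
by rewrite -[e `^ q]invrK lef_pV2 ?posrE ?invr_gt0 ?powR_gt0// ltW.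
Qed.

Lemma thin_ell1_inf mu D e : X = Ellp 1 -> thin mu D e ->
  (ereal_inf [set (modulus (mu u))%:E | u in D] <= e%:E)%E.
Proof.
move=> XE /thin_sum_modulus[A [g [AD sg ge]]]; rewrite leNgt; apply/negP => lt_inf.
(* A real lower bound above [e] for the weights on [D]; if the infimum is infinite, [e + 1] will do.
   It forces the norm of [g] to be at least [m]. *)
have [m em m_inf] : exists2 m : R, e < m &
    (m%:E <= ereal_inf [set (modulus (mu u))%:E | u in D])%E.
  case: ereal_inf lt_inf => [m|_|//]; first by rewrite lte_fin => em; exists m.
  by exists (e + 1); rewrite ?ltrDl// leey.
have e0 : 0 <= e := le_trans (finnorm_ge0 _ _ _ _) ge.
have m0 : 0 < m := le_lt_trans e0 em.
move: ge; rewrite (finnorm_ellP mu hX _ _ XE e0) powRr1// leNgt => /negP; apply.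
apply: lt_le_trans em _; rewrite -[m]mulr1 (le_trans (ler_wpM2l (ltW m0) sg))//.
rewrite mulr_sumr big_seq [leRHS]big_seq ler_sum// => u uA.
rewrite powRr1 ?modulus_ge0// modulusM mulrC ler_wpM2l ?modulus_ge0//.
rewrite -lee_fin; apply: le_trans m_inf _; apply: ereal_inf_lbound.
by exists u => //; exact: AD.
Qed.

(** One vertex of small weight, with coefficient 1, is a witness. *)
Lemma inf_thin_ell1 mu D e : X = Ellp 1 ->
  (ereal_inf [set (modulus (mu u))%:E | u in D] < e%:E)%E -> thin mu D e.
Proof.
move=> XE /ereal_inf_lt[_ [u Du <-]]; rewrite lte_fin => ue.
apply: (@thin_sum mu D e 1 [fset u]%fset (fun=> 1)) => //.
- by move=> v /=; rewrite inE => /eqP->.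
- by rewrite big_seq_fset1 modulus1.
by rewrite finnorm1// mul1r mulr1 ltW.
Qed.

End Thin.

(** * The conditions in terms of thin sets *)

Section Convergence.
Variable R : realType.

Lemma near_inftyP (P : nat -> Prop) :
  (\forall k \near \oo, P k) <-> exists N, forall k, (N <= k)%N -> P k.
Proof. by split=> [[N _ hN]|[N hN]]; exists N. Qed.

Lemma invS_le (e : R) m : 0 < e -> (Num.bound e^-1 <= m)%N -> m.+1%:R^-1 <= e.
Proof.
move=> e0 em; rewrite -[e]invrK lef_pV2 ?posrE ?invr_gt0//.
apply: le_trans (ltW (archi_boundP _)) _; first by rewrite invr_ge0 ltW.
by rewrite ler_nat ltnW.
Qed.

Lemma cvg_pinftyP (u : nat -> \bar R) : u @ \oo --> +oo%E <->
  forall M, 0 < M -> exists N, forall k, (N <= k)%N -> (M%:E <= u k)%E.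
Proof.
rewrite cvgeyPge; split=> h M; first by move=> _; exact/near_inftyP.
apply/near_inftyP; have [N hN] := h (`|M| + 1) ltac:(by rewrite ltr_wpDl).
exists N => k /hN; apply: le_trans; rewrite lee_fin.
by apply: le_trans (ler_norm _) _; rewrite lerDl.
Qed.

Lemma cvg_zeroP (u : nat -> \bar R) : (forall k, (0 <= u k)%E) ->
  u @ \oo --> 0%E <->
  forall e, 0 < e -> exists N, forall k, (N <= k)%N -> (u k <= e%:E)%E.
Proof.
move=> u0; split=> [/fine_cvgP[fu cu] e e0|h].
  move/cvgrPdist_le : cu => /(_ e e0) cu; apply/near_inftyP.
  near=> k; have fk : u k \is a fin_num by near: k.
  rewrite -(fineK fk) lee_fin; have : `|0 - fine (u k)| <= e by near: k.
  by rewrite sub0r normrN ger0_norm// fine_ge0.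
apply/fine_cvgP; split.
  have /near_inftyP := h 1 ltr01; apply: filterS => k uk.
  by rewrite ge0_fin_numE// (le_lt_trans uk)// ltry.
apply/cvgrPdist_le => e e0; have /near_inftyP := h e e0; apply: filterS => k uk.
have fk : u k \is a fin_num by rewrite ge0_fin_numE// (le_lt_trans uk)// ltry.
by rewrite sub0r normrN ger0_norm ?fine_ge0// -lee_fin fineK.
Unshelve. all: by end_near. Qed.

End Convergence.

Section Conditions.
Variables (R : realType) (b : scalar_kind) (V : countType).
Local Notation K := (scalar_field R b).
Variables (mu : V -> K) (X : space_kind R).
Hypotheses (hX : admissible X) (mu_neq0 : forall v, mu v != 0).
Variables (D : nat -> set V) (l : nat -> K).
Hypothesis l_neq0 : forall k, l k != 0.
Implicit Types (e q M : R).

Definition chi_condition : Prop :=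
  match X with
  | Ellp p =>
      if p == 1 then
        ereal_inf [set (modulus (mu u) / modulus (l k))%:E | u in D k]
          @[k --> \oo] --> 0%E
      else
        (\esum_(u in D k) (modulus (l k) `^ conj_exponent p
           / modulus (mu u) `^ conj_exponent p)%:E) @[k --> \oo] --> +oo%E
  | C0 =>
      (\esum_(u in D k) (modulus (l k) / modulus (mu u))%:E)
        @[k --> \oo] --> +oo%E
  end.

(** In the application [l k] is the product of the [k]-th scalar with the weight of the [n k]-th
    ancestor, whereas in [chi_condition] it is the scalar alone. *)
Definition par_condition : Prop :=
  match X with
  | Ellp p =>
      if p == 1 then
        Order.min (modulus (l k))%:E (ereal_inf [set (modulus (mu u))%:E | u in D k])
          @[k --> \oo] --> 0%E
      else
        ((modulus (l k) `^ conj_exponent p)^-1%:E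
          + \esum_(u in D k) (modulus (mu u) `^ conj_exponent p)^-1%:E)%E
          @[k --> \oo] --> +oo%E
  | C0 =>
      ((modulus (l k))^-1%:E + \esum_(u in D k) (modulus (mu u))^-1%:E)%E
        @[k --> \oo] --> +oo%E
  end.

Lemma powRVK M q : 0 < M -> 0 < q -> ((M^-1 `^ q^-1) `^ q)^-1 = M.
Proof.
move=> M0 q0; rewrite -powRrM mulVf ?gt_eqF//.
by rewrite powRr1 ?invrK// invr_ge0 ltW.
Qed.

Lemma esum_chi_thin q : dual_exponent b V X q ->
  (\esum_(u in D k) (modulus (l k) `^ q / modulus (mu u) `^ q)%:E) @[k --> \oo] --> +oo%E
  <-> forall e, 0 < e -> exists N, forall k, (N <= k)%N ->
    thin X mu (D k) (e * modulus (l k)).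
Proof.
move=> [q0 thin_dual dual_thin].
have ml_neq0 k u : mu u / l k != 0 by rewrite mulf_neq0// invr_eq0.
have E k : \esum_(u in D k) (modulus (l k) `^ q / modulus (mu u) `^ q)%:E =
    \esum_(u in D k) (modulus (mu u / l k) `^ q)^-1%:E.
  apply: eq_esum => u _; congr EFin.
  rewrite modulusM modulusV powRM ?invr_ge0 ?modulus_ge0// invfM mulrC; congr (_ * _).
  by rewrite powRV ?modulus_ge0// invrK.
rewrite cvg_pinftyP; split=> h.
  move=> e e0; have eq0 : 0 < e `^ q by exact: powR_gt0.
  (* The added 1 provides the strict inequality that [dual_thin] asks for. *)
  have [|N hN] := h ((e `^ q)^-1 + 1); first by rewrite addr_gt0 ?invr_gt0.
  exists N => k /hN; rewrite E => hk; apply/(thinZ hX)/dual_thin => //.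
  by apply: lt_le_trans hk; rewrite lte_fin ltrDl.
(* This is the [e] for which the dual bound [(e ^ q)^-1] equals [M]. *)
move=> M M0; have [|N hN] := h (M^-1 `^ q^-1); first by rewrite powR_gt0 ?invr_gt0.
exists N => k /hN /(thinZ hX) => /(_ (l_neq0 k)) /thin_dual; rewrite -E.
move=> /(_ (ml_neq0 k)); rewrite powR_gt0 ?invr_gt0// => /(_ isT).
by rewrite powRVK.
Qed.

Lemma esum_par_thin q : dual_exponent b V X q ->
  ((modulus (l k) `^ q)^-1%:E + \esum_(u in D k) (modulus (mu u) `^ q)^-1%:E)%E
    @[k --> \oo] --> +oo%E
  <-> forall e, 0 < e -> exists N, forall k, (N <= k)%N ->
    modulus (l k) <= e \/ thin X mu (D k) e.
Proof.
move=> [q0 thin_dual dual_thin].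
have lt0 k : 0 < modulus (l k) `^ q by rewrite powR_gt0 ?modulus_gt0.
have sum0 k : (0 <= \esum_(u in D k) (modulus (mu u) `^ q)^-1%:E)%E.
  by apply: esum_ge0 => u _; rewrite lee_fin invr_powR_ge0.
rewrite cvg_pinftyP; split=> h.
  move=> e e0; have eq0 : 0 < e `^ q by exact: powR_gt0.
  (* If the modulus of [l k] exceeds [e], the first term uses up at most one copy of [(e ^ q)^-1],
     and the sum over [D k] must exceed the other. *)
  have [|N hN] := h ((e `^ q)^-1 + (e `^ q)^-1 + 1).
    by rewrite addr_gt0 ?addr_gt0 ?invr_gt0.
  exists N => k /hN hk; have [le_e|lt_e] := leP (modulus (l k)) e; [by left|right].
  apply: dual_thin => //; rewrite ltNge; apply/negP => sum_le.
  have le_l : ((modulus (l k) `^ q)^-1%:E <= (e `^ q)^-1%:E)%E.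
    rewrite lee_fin lef_pV2 ?posrE//; apply: ge0_ler_powR; rewrite ?nnegrE ?ltW//.
    by rewrite modulus_gt0.
  by have := le_trans hk (leeD le_l sum_le); rewrite -EFinD lee_fin gerDl ler10.
move=> M M0; have [|N hN] := h (M^-1 `^ q^-1); first by rewrite powR_gt0 ?invr_gt0.
have E := powRVK M0 q0.
have e0 : 0 < M^-1 `^ q^-1 by rewrite powR_gt0 ?invr_gt0.
exists N => k /hN [le_l|/thin_dual]; last first.
  move=> /(_ mu_neq0 e0); rewrite E => /le_trans; apply.
  by rewrite leeDr// lee_fin invr_powR_ge0.
apply: le_trans (leeDl _ (sum0 k)); rewrite lee_fin -{1}E.
rewrite lef_pV2 ?posrE//; last exact: powR_gt0.
by apply: ge0_ler_powR => //; rewrite ?nnegrE ?modulus_ge0 ?powR_ge0 ?ltW.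
Qed.

Lemma inf_modulus_ge0 (w : V -> R) (A : set V) : (forall u, 0 <= w u) ->
  (0 <= ereal_inf [set (w u)%:E | u in A])%E.
Proof. by move=> w0; apply: le_ereal_inf_tmp => _ [u _ <-]; rewrite lee_fin. Qed.

Lemma inf_chi_thin : X = Ellp 1 ->
  ereal_inf [set (modulus (mu u) / modulus (l k))%:E | u in D k] @[k --> \oo] --> 0%E
  <-> forall e, 0 < e -> exists N, forall k, (N <= k)%N ->
    thin X mu (D k) (e * modulus (l k)).
Proof.
move=> XE; rewrite cvg_zeroP; last first.
  by move=> k; apply: inf_modulus_ge0 => u; rewrite divr_ge0 ?modulus_ge0.
have E k : [set (modulus (mu u) / modulus (l k))%:E | u in D k] =
    [set (modulus (mu u / l k))%:E | u in D k].
  by apply: eq_imagel => u _; rewrite modulusM modulusV.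
split=> h e e0.
  have [|N hN] := h (e / 2); first by rewrite divr_gt0.
  exists N => k /hN; rewrite E => hk; apply/(thinZ hX) => //.
  apply: (inf_thin_ell1 hX XE); apply: le_lt_trans hk _.
  by rewrite lte_fin ltr_pdivrMr// mulr_natr mulr2n ltrDl.
have [N hN] := h e e0; exists N => k /hN /(thinZ hX) => /(_ (l_neq0 k)).
by rewrite E; exact: thin_ell1_inf.
Qed.

Lemma inf_par_thin : X = Ellp 1 ->
  Order.min (modulus (l k))%:E (ereal_inf [set (modulus (mu u))%:E | u in D k])
    @[k --> \oo] --> 0%E
  <-> forall e, 0 < e -> exists N, forall k, (N <= k)%N ->
    modulus (l k) <= e \/ thin X mu (D k) e.
Proof.
move=> XE; rewrite cvg_zeroP; last first.
  move=> k; rewrite le_min lee_fin modulus_ge0 /=.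
  by apply: inf_modulus_ge0 => u; exact: modulus_ge0.
split=> h e e0.
  have [|N hN] := h (e / 2); first by rewrite divr_gt0.
  have e2 : e / 2 < e by rewrite ltr_pdivrMr// mulr_natr mulr2n ltrDl.
  exists N => k /hN; rewrite ge_min lee_fin => /orP[hk|hk].
    by left; exact: le_trans hk (ltW e2).
  by right; apply: (inf_thin_ell1 hX XE); apply: le_lt_trans hk _; rewrite lte_fin.
have [N hN] := h e e0; exists N => k /hN hk; rewrite ge_min lee_fin.
by case: hk => [->|/(thin_ell1_inf hX XE)->] //; rewrite orbT.
Qed.

Lemma chi_conditionP : chi_condition <->
  forall e, 0 < e -> exists N, forall k, (N <= k)%N ->
    thin X mu (D k) (e * modulus (l k)).
Proof.
rewrite /chi_condition; case XE : {1}X => [p|].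
  have [p1|p1] := eqVneq p 1; first by apply: inf_chi_thin; rewrite XE p1.
  apply: esum_chi_thin; apply: dual_exponent_ell => //.
  by rewrite lt_neqAle eq_sym p1 /=; move: hX; rewrite XE.
rewrite -(esum_chi_thin (dual_exponent_c0 b V hX XE)).
suff -> : (fun k => \esum_(u in D k) (modulus (l k) / modulus (mu u))%:E) =
  (fun k => \esum_(u in D k) (modulus (l k) `^ 1 / modulus (mu u) `^ 1)%:E) by [].
by apply/funext => k; apply: eq_esum => u _; rewrite !powRr1 ?modulus_ge0.
Qed.

Lemma par_conditionP : par_condition <->
  forall e, 0 < e -> exists N, forall k, (N <= k)%N ->
    modulus (l k) <= e \/ thin X mu (D k) e.
Proof.
rewrite /par_condition; case XE : {1}X => [p|].
  have [p1|p1] := eqVneq p 1; first by apply: inf_par_thin; rewrite XE p1.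
  apply: esum_par_thin; apply: dual_exponent_ell => //.
  by rewrite lt_neqAle eq_sym p1 /=; move: hX; rewrite XE.
rewrite -(esum_par_thin (dual_exponent_c0 b V hX XE)).
suff -> : (fun k => ((modulus (l k))^-1%:E +
    \esum_(u in D k) (modulus (mu u))^-1%:E)%E) =
  (fun k => ((modulus (l k) `^ 1)^-1%:E +
    \esum_(u in D k) (modulus (mu u) `^ 1)^-1%:E)%E) by [].
apply/funext => k; rewrite powRr1 ?modulus_ge0//; congr (_ + _)%E.
by apply: eq_esum => u _; rewrite powRr1 ?modulus_ge0.
Qed.

End Conditions.

(** * From recurrence to the conditions *)

(** Recursive choice in which each lower bound is one more than the previous index; starting from
    the bound 1 makes the indices positive. *)
Lemma choose_increasing (T : Type) (P : nat -> nat -> T -> Prop) :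
  (forall k N, exists n t, (N <= n)%N /\ P k n t) ->
  exists n t, [/\ forall k, (0 < n k)%N, forall k, (n k < n k.+1)%N &
                  forall k, P k (n k) (t k)].
Proof.
move=> h.
have [|phi hphi] := @choice _ _ (fun kN nt : nat * _ =>
    (kN.2 <= nt.1)%N /\ P kN.1 nt.1 nt.2).
  by move=> [k N]; have [n [t ?]] := h k N; exists (n, t).
pose r := fix r k := if k is k'.+1 then phi (k, (r k').1.+1) else phi (0%N, 1%N).
have r_lt k : ((r k).1 < (r k.+1).1)%N by exact: (hphi (k.+1, (r k).1.+1)).1.
exists (fun k => (r k).1), (fun k => (r k).2); split=> // k.
  by case: k => [|k]; [exact: (hphi (0%N, 1%N)).1|exact: leq_ltn_trans (r_lt k)].
by case: k => [|k]; [exact: (hphi (0%N, 1%N)).2|exact: (hphi (k.+1, (r k).1.+1)).2].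
Qed.

Lemma fset_positive_lower_bound (R : realType) (V : choiceType) (A : {fset V})
    (a : V -> R) : (forall v, 0 < a v) ->
  exists2 m, 0 < m & forall v, v \in A -> m <= a v.
Proof.
move=> a0; suff [m m0 hm] : exists2 m, 0 < m & forall v, v \in enum_fset A -> m <= a v.
  by exists m.
elim: (enum_fset A) => [|w s [m m0 hm]]; first by exists 1.
exists (Num.min m (a w)); first by rewrite lt_min m0 a0.
by move=> v; rewrite inE ge_min => /orP[/eqP->|/hm->]; rewrite ?lexx ?orbT.
Qed.

Section RecurrenceToConditions.
Variables (R : realType) (b : scalar_kind) (V : countType) (E : rel V).
Local Notation K := (scalar_field R b).
Variables (mu : V -> K) (X : space_kind R) (Gamma : set K).
Hypotheses (htree : directed_tree E) (hunrooted : unrooted E).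
Hypotheses (mu_neq0 : forall v, mu v != 0) (hX : admissible X).
Hypothesis hB : bounded_backward_shift E mu X.
Local Notation T := (@backward_shift R b V E).
Local Notation inX := (in_space mu X).
Local Notation normX := (space_norm mu X).
Hypothesis hrec : recurrent mu X Gamma T.
Implicit Types (F G : {fset V}).

(** The recurrent vector near the indicator of [F] is truncated only after [n] and [l] are fixed, so
    the truncation error can be made small against the norm of [l] times the [n]-th iterate. *)
Lemma finite_recurrence F (d : R) N : 0 < d -> exists n l G y,
  [/\ (N <= n)%N, Gamma l, supported y G,
      normX (y \- cutoff F (fun=> 1)) <= d &
      normX (l \*o iter n T y \- y) <= d].
Proof.
move=> d0; pose f : V -> K := cutoff F (fun=> 1).
have fX : inX f := in_space_supported mu hX (@cutoff_supported _ _ _ F _).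
have d30 : 0 < d / 3 by rewrite divr_gt0.
have [x [[_ [n [l [_ n_incr Gl cvg_l]]]] [xX xf]]] := hrec fX d30.
have n_ge k : (k <= n k)%N by elim: k => // k IH; exact: leq_ltn_trans (n_incr k).
have [k Nk lk] : exists2 k, (N <= k)%N & normX (l k \*o iter (n k) T x \- x) <= d / 3.
  move/cvgrPdist_le : cvg_l => /(_ _ d30)/near_inftyP [M hM].
  exists (maxn N M); first exact: leq_maxl.
  have := hM _ (leq_maxr N M).
  by rewrite sub0r normrN ger0_norm ?space_norm_ge0.
have [C C0 hC] := iter_shift_bounded hB (n k).
have lC0 : 0 < modulus (l k) * C + 1 by rewrite ltr_wpDl// mulr_ge0 ?modulus_ge0// ltW.
have [G hG] := cutoff_approx hX xX (divr_gt0 d30 lC0).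
set y := cutoff G x in hG; have yX : inX y := in_space_supported mu hX (@cutoff_supported _ _ _ G x).
have := hG G (fun _ => id); rewrite -/y ler_pdivlMr// => xy.
have xy0 := space_norm_ge0 mu X (x \- y).
have xy1 : normX (x \- y) <= d / 3.
  by apply: le_trans xy; rewrite ler_peMr// lerDr mulr_ge0 ?modulus_ge0// ltW.
have xy2 : normX (l k \*o iter (n k) T x \- l k \*o iter (n k) T y) <= d / 3.
  have -> : l k \*o iter (n k) T x \- l k \*o iter (n k) T y =
      l k \*o iter (n k) T (x \- y).
    by rewrite (iter_shiftB hB)//; apply/funext => v /=; rewrite mulrBr.
  apply: le_trans (space_normZ hX _ (in_space_iter_shift hB _ (in_spaceB hX xX yX))) _.
  apply: le_trans (ler_wpM2l (modulus_ge0 _) (hC _ (in_spaceB hX xX yX))) _.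
  by apply: le_trans xy; rewrite mulrA mulrC ler_wpM2l// lerDl.
have lTX z : inX z -> inX (l k \*o iter (n k) T z).
  by move=> zX; apply: in_spaceZ => //; exact: in_space_iter_shift.
exists (n k), (l k), G, y; split=> //.
- exact: leq_trans Nk (n_ge k).
- exact: cutoff_supported.
- have := space_norm_tri hX yX xX fX; rewrite [normX (y \- x)]space_norm_distC.
  by rewrite -/f; lra.
- have := space_norm_tri hX (lTX _ yX) (lTX _ xX) yX.
  have := space_norm_tri hX (lTX _ xX) xX yX.
  rewrite [normX (_ \- l k \*o iter (n k) T x)]space_norm_distC; lra.
Qed.

Lemma recurrence_step F (v0 : V) (e : R) N : v0 \in F -> 0 < e -> exists n l,
  [/\ (N <= n)%N, Gamma l, l != 0 &
    forall v, v \in F -> thin X mu (Chin E n v) (e * modulus l) /\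
      (modulus (l * mu (iter n (par E) v)) <= e \/
       thin X mu (Chin E n (iter n (par E) v)) e)].
Proof.
move=> v0F e0.
have [M hM] := iter_par_avoid htree hunrooted F.
have [m m0 hm] := @fset_positive_lower_bound R V F (fun v => modulus (mu v))
  (fun v => etrans (modulus_gt0 _) (mu_neq0 v)).
(* [c] bounds the deviation of [y] from 1 at each point of [F]; the deviations over all of [F] add
   up to at most 1/4. *)
pose c : R := (4 * ((size F)%:R + 1))^-1.
have sF : 0 <= (size F)%:R :> R by exact: ler0n.
have c0 : 0 < c by rewrite invr_gt0; lra.
have c4 : c <= 1 / 4.
  by rewrite /c div1r lef_pV2 ?posrE; lra.
have cF : c * (size F)%:R <= 1 / 4.
  by rewrite /c mulrC ler_pdivrMr; lra.
(* [d <= m * c] turns norm bounds into errors of at most [c] at the points of [F]; [8 * d <= e]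
   makes the modulus of [l * mu w] at most [e] once that of [S w] is at least 1/4, and gives
   [d <= e / 2] for thinness. *)
have [d d0 [de dm]] : exists2 d : R, 0 < d & 8 * d <= e /\ d <= m * c.
  exists (Num.min (e / 8) (m * c)); first by rewrite lt_min divr_gt0 ?mulr_gt0.
  have : Num.min (e / 8) (m * c) <= e / 8 by rewrite ge_min lexx.
  by split; [lra|rewrite ge_min lexx orbT].
have [n [l [G [y [Nn Gl yG yF ly]]]]] := finite_recurrence F (maxn N M) d0.
have /andP[Nn' Mn] : (N <= n)%N && (M <= n)%N by rewrite -geq_max.
have yX : inX y := in_space_supported mu hX yG.
have fX : inX (cutoff F (fun=> 1)) := in_space_supported mu hX (@cutoff_supported _ _ _ F _).
have yfX := in_spaceB hX yX fX.
have lyX : inX (l \*o iter n T y \- y).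
  apply: in_spaceB => //; apply: in_spaceZ => //; exact: in_space_iter_shift.
pose A w := [fset u in G | iter n (par E) u == w]%fset.
pose S w := \sum_(u <- A w) y u.
have TS w : iter n T y w = S w.
  by rewrite (iter_shift_supported htree hunrooted n w yG) big_fset_condE.
have AChin w : [set` A w] `<=` Chin E n w.
  move=> u /=; rewrite !inE /= => /andP[_ /eqP uw].
  exact/(ChinP htree hunrooted).
have y_near v : v \in F -> modulus (y v - 1) <= c.
  move=> vF; have := le_trans (norm_coord hX v yfX) yF; rewrite /= /cutoff vF => h.
  have mv := hm _ vF; rewrite -(ler_pM2r m0); apply: le_trans (le_trans h _); last first.
    by rewrite mulrC.
  by rewrite ler_wpM2l ?modulus_ge0.
have y_far B : (forall u, u \in B -> u \notin F) -> finnorm mu X B y <= d.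
  move=> BF; apply: le_trans (le_trans (finnorm_le_norm hX B yfX) yF).
  by apply: finnorm_mono => // u uB; right; rewrite /= /cutoff (negbTE (BF u uB)) subr0.
(* [l * S v] is within [c] of [y v], which is within [c] of 1, and [2 * c <= 1 / 2]. In particular
   [l] cannot be 0. *)
have half v : v \in F -> 1 / 2 <= modulus l * modulus (S v).
  move=> vF; have mv := hm _ vF.
  have h1 : modulus (l * S v - y v) <= c.
    have := le_trans (norm_coord hX v lyX) ly; rewrite /= TS => h.
    rewrite -(ler_pM2r m0); apply: le_trans (le_trans h _); last by rewrite mulrC.
    by rewrite ler_wpM2l ?modulus_ge0.
  have h2 := y_near v vF; rewrite -modulusM.
  have := modulusB_ge (1 : K) (1 - l * S v).
  rewrite modulus1 subKr; have := modulusB_tri 1 (y v) (l * S v).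
  rewrite (modulusB 1 (y v)) (modulusB (y v) (l * S v)); lra.
have l0 : l != 0.
  apply/negP => /eqP l0; have := half _ v0F; rewrite l0 modulus0 mul0r; lra.
exists n, l; split=> // v vF; have ml0 : 0 < modulus l by rewrite modulus_gt0.
split.
  apply: (@thin_sum R b V X hX mu _ _ (1 / (2 * modulus l)) (A v) y) => //.
  - by rewrite divr_gt0// mulr_gt0.
  - by rewrite ler_pdivrMr ?mulr_gt0//; have := half _ vF; rewrite /S; lra.
  have -> : e * modulus l * (1 / (2 * modulus l)) = e / 2 by field; rewrite gt_eqF.
  apply: le_trans (y_far _ _) _; last by lra.
  (* The [n]-th ancestor of a vertex of [F] is outside [F], whereas that of [u] is [v]. *)
  move=> u; rewrite !inE /= => /andP[_ /eqP uv]; apply/negP => uF.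
  by have := hM n Mn u uF; rewrite uv vF.
set w := iter n (par E) v; have wF : w \notin F := hM n Mn v vF.
have lSw : modulus (l * mu w) * modulus (S w) <= 2 * d.
  have := le_trans (norm_coord hX w lyX) ly; rewrite /= TS => h1.
  have := y_far [fset w]%fset; rewrite finnorm1// => /(_ _)/wrap[|h2].
    by move=> u; rewrite inE => /eqP->.
  have -> : modulus (l * mu w) * modulus (S w) = modulus (l * S w) * modulus (mu w).
    by rewrite !modulusM; ring.
  apply: le_trans (_ : (modulus (l * S w - y w) + modulus (y w)) * modulus (mu w) <= _).
    by rewrite ler_wpM2r ?modulus_ge0// -{1}(subrK (y w) (l * S w)) modulusD.
  by rewrite mulrDl -[X in _ + X]modulusM; lra.
(* The part of [S w] over [F] is close to a count that includes [v], hence at least 3/4 in modulus.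
   If [S w] is below 1/4, the part outside [F] must be at least 1/2. *)
have [Sw|Sw] := leP (1 / 4) (modulus (S w)).
  left; have := modulus_ge0 (l * mu w); nra.
right; apply: (@thin_sum R b V X hX mu _ _ (1 / 2) (A w `\` F)%fset y).
- by apply: subset_trans (AChin w) => u /=; rewrite inE => /andP[].
- by rewrite divr_gt0.
- set B := (A w `&` F)%fset.
  have SE : S w = \sum_(u <- B) y u + \sum_(u <- (A w `\` F)%fset) y u.
    rewrite /S (big_fsetID _ [pred u | u \in F])/=; congr (_ + _); apply: eq_fbigl => u.
      by rewrite !inE.
    by rewrite !inE andbC.
  have vB : v \in B.
    rewrite !inE /= eqxx vF !andbT; apply/negPn/negP => /yG yv.
    by have := y_near v vF; rewrite yv sub0r modulusN modulus1; lra.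
  have By : modulus (\sum_(u <- B) y u - (size B)%:R) <= 1 / 4.
    have -> : \sum_(u <- B) y u - (size B)%:R = \sum_(u <- B) (y u - 1).
      by rewrite sumrB big_const_seq count_predT iter_addr addr0.
    apply: le_trans (modulus_sum _ _ _) _; apply: le_trans cF.
    apply: le_trans (@fsum_le R V B F _ (fun=> c) _ _) _.
    + by move=> u _; exact: ltW.
    + by move=> u; rewrite inE => /andP[_ uF]; right; split=> //; exact: y_near.
    by rewrite big_const_seq count_predT iter_addr addr0 mulr_natr.
  have sB : 1 <= (size B)%:R :> R.
    by rewrite ler1n; have : v \in enum_fset B by []; case: (enum_fset B).
  have := modulusB_ge ((size B)%:R : K) (\sum_(u <- B) y u).
  rewrite modulus_nat modulusB => h1.
  have := modulusD (S w) (- \sum_(u <- (A w `\` F)%fset) y u).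
  by rewrite modulusN {1}SE addrK; lra.
apply: le_trans (y_far _ _) _; last by lra.
by move=> u; rewrite inE => /andP[].
Qed.

Lemma recurrent_conditions : exists n l,
  [/\ (forall k, 0 < n k)%N, (forall k, n k < n k.+1)%N,
      (forall k, Gamma (l k) /\ l k != 0) &
      forall v e, 0 < e -> exists N, forall k, (N <= k)%N ->
        thin X mu (Chin E (n k) v) (e * modulus (l k)) /\
        (modulus (l k * mu (iter (n k) (par E) v)) <= e \/
         thin X mu (Chin E (n k) (iter (n k) (par E) v)) e)].
Proof.
have [v0 _] := tree_nonempty htree.
(* Finite sets that exhaust [V] along its enumeration, paired with the tolerances [k.+1%:R^-1]; [v0]
   keeps them non-empty, which makes the scalars non-zero. *)
pose F k : {fset V} := (v0 |` [fset v in pmap (@choice.unpickle V) (iota 0 k)])%fset.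
have inF v k : (choice.pickle v < k)%N -> v \in F k.
  move=> vk; rewrite !inE /= mem_pmap; apply/orP; right; apply/mapP.
  by exists (choice.pickle v); rewrite ?mem_iota ?choice.pickleK ?add0n.
have [|n [l [n0 n_incr hnl]]] := @choose_increasing K (fun k n l =>
    [/\ Gamma l, l != 0 & forall v, v \in F k ->
      thin X mu (Chin E n v) (k.+1%:R^-1 * modulus l) /\
      (modulus (l * mu (iter n (par E) v)) <= k.+1%:R^-1 \/
       thin X mu (Chin E n (iter n (par E) v)) k.+1%:R^-1)]).
  move=> k N; have v0F : v0 \in F k by rewrite !inE eqxx.
  have k0 : 0 < k.+1%:R^-1 :> R by rewrite invr_gt0.
  have [n [l [? ? ? ?]]] := recurrence_step N v0F k0.
  by exists n, l; split=> //; split.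
exists n, l; split=> // [k|v e e0]; first by have [] := hnl k.
exists (maxn (choice.pickle v).+1 (Num.bound e^-1)) => k.
rewrite geq_max => /andP[vk ek].
have ke := invS_le e0 ek.
have [_ _ /(_ v (inF v k vk)) [h1 h2]] := hnl k; split.
  by apply: thin_le h1; rewrite ler_wpM2r ?modulus_ge0.
case: h2 => [h2|h2]; first by left; exact: le_trans h2 ke.
by right; exact: thin_le h2.
Qed.

End RecurrenceToConditions.

(** * From the conditions to supercyclicity *)

Section Combinations.
Variables (R : realType) (b : scalar_kind) (V : countType).
Local Notation K := (scalar_field R b).
Variables (mu : V -> K) (X : space_kind R).
Hypothesis hX : admissible X.
Local Notation inX := (in_space mu X).
Local Notation normX := (space_norm mu X).
Implicit Types (v w : V) (f : V -> K).

Definition unitvec w : V -> K := fun v => (v == w)%:R.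

Lemma unitvec_supported w : supported (unitvec w) [fset w]%fset.
Proof. by move=> v; rewrite inE /unitvec => /negbTE->. Qed.

Lemma in_space_unitvec w : inX (unitvec w).
Proof. exact: in_space_supported (@unitvec_supported w). Qed.

Lemma norm_unitvec w : normX (unitvec w) = modulus (mu w).
Proof.
rewrite (norm_supported mu hX (@unitvec_supported w)) finnorm1//.
by rewrite /unitvec eqxx mul1r.
Qed.

(** Finitely supported vectors as lists of vertices with coefficients, for arguments by linearity
    and, with rational coefficients, for enumeration. *)
Definition comb (s : seq (V * K)) : V -> K :=
  foldr (fun t f => t.2 \*o unitvec t.1 \+ f) (fun=> 0) s.

Lemma in_space_comb s : inX (comb s).
Proof.
elim: s => [|t s IH] /=; first exact: (@in_space_supported _ _ _ mu _ hX fset0).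
by apply: in_spaceD => //; apply: in_spaceZ => //; exact: in_space_unitvec.
Qed.

Lemma cutoff_comb (A : {fset V}) f : cutoff A f = comb [seq (w, f w) | w <- enum_fset A].
Proof.
apply/funext => v; rewrite /cutoff -[v \in A]/(v \in enum_fset A).
elim: (enum_fset A) (fset_uniq A) => //= w s IH /andP[ws us].
rewrite inE -(IH us) /unitvec /=; have [->|vw] /= := eqVneq v w.
  by rewrite mulr1 (negbTE ws) addr0.
by rewrite mulr0 add0r.
Qed.

Definition rat_comb (s : seq (V * (rat * rat))) : V -> K :=
  comb [seq (t.1, of_rat2 R b t.2) | t <- s].

Lemma rat_comb_dense f e : inX f -> 0 < e -> exists s, normX (f \- rat_comb s) <= e.
Proof.
move=> fX e0; have e20 : 0 < e / 2 by rewrite divr_gt0.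
have [A /(_ A (fun _ => id))] := cutoff_approx hX fX e20.
have cX := in_space_comb; rewrite cutoff_comb.
set t := [seq (w, f w) | w <- enum_fset A] => fA.
suff [s hs] : exists s, normX (comb t \- rat_comb s) <= e / 2.
  exists s; have := space_norm_tri hX fX (cX t) (cX _ : inX (rat_comb s)); lra.
(* Half of the tolerance is spent on the first coefficient and half on the remaining ones. *)
elim: {fA} t (e / 2) e20 => [|[w a] t IH] d d0.
  exists [::]; rewrite (norm_supported mu hX (A := fset0)); last first.
    by move=> v _ /=; rewrite subrr.
  by rewrite finnorm_eq0 ?ltW.
have d20 : 0 < d / 2 by rewrite divr_gt0.
have mw0 : 0 < modulus (mu w) + 1 by rewrite ltr_wpDl ?modulus_ge0.
have [s hs] := IH _ d20; have [q hq] := of_rat2_dense a (divr_gt0 d20 mw0).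
exists ((w, q) :: s).
have -> : comb ((w, a) :: t) \- rat_comb ((w, q) :: s) =
    ((a - of_rat2 R b q) \*o unitvec w) \+ (comb t \- rat_comb s).
  by apply/funext => v; rewrite /= mulrBl opprD addrACA.
apply: le_trans (space_normD hX _ _) _.
- by apply: in_spaceZ => //; exact: in_space_unitvec.
- by apply: in_spaceB => //; exact: cX.
have := space_normZ hX (a - of_rat2 R b q) (in_space_unitvec w).
rewrite norm_unitvec; move: hq; rewrite ltr_pdivlMr//.
have := modulus_ge0 (a - of_rat2 R b q); nra.
Qed.

End Combinations.

Section ConditionsToSupercyclicity.
Variables (R : realType) (b : scalar_kind) (V : countType) (E : rel V).
Local Notation K := (scalar_field R b).
Variables (mu : V -> K) (X : space_kind R).
Hypotheses (htree : directed_tree E) (hunrooted : unrooted E).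
Hypothesis hX : admissible X.
Hypothesis hB : bounded_backward_shift E mu X.
Local Notation T := (@backward_shift R b V E).
Local Notation inX := (in_space mu X).
Local Notation normX := (space_norm mu X).
Variables (n : nat -> nat) (l : nat -> K).
Hypothesis l_neq0 : forall k, l k != 0.
Hypothesis chi_thin : forall v e, 0 < e -> exists N, forall k, (N <= k)%N ->
  thin X mu (Chin E (n k) v) (e * modulus (l k)).
Hypothesis par_thin : forall v e, 0 < e -> exists N, forall k, (N <= k)%N ->
  modulus (l k * mu (iter (n k) (par E) v)) <= e \/
  thin X mu (Chin E (n k) (iter (n k) (par E) v)) e.
Local Notation vzero := (fun _ : V => 0 : K).
Implicit Types (y z d : V -> K) (e : R).

(** Asking for all large [k] instead of some [k] lets two pairs share the same [k], so that they can
    be added. *)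
Definition reach y z := forall e, 0 < e -> exists N, forall k, (N <= k)%N ->
  exists d, [/\ inX d, normX d <= e & normX (l k \*o iter (n k) T (y \+ d) \- z) <= e].

Lemma in_space_orbit k f : inX f -> inX (l k \*o iter (n k) T f).
Proof. by move=> fX; apply: in_spaceZ => //; exact: in_space_iter_shift. Qed.

Lemma reachD y1 z1 y2 z2 : inX y1 -> inX z1 -> inX y2 -> inX z2 ->
  reach y1 z1 -> reach y2 z2 -> reach (y1 \+ y2) (z1 \+ z2).
Proof.
move=> y1X z1X y2X z2X h1 h2 e e0; have e20 : 0 < e / 2 by rewrite divr_gt0.
have [N1 hN1] := h1 _ e20; have [N2 hN2] := h2 _ e20.
exists (maxn N1 N2) => k; rewrite geq_max => /andP[/hN1[d1 [d1X d1e hd1]] /hN2[d2 [d2X d2e hd2]]].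
exists (d1 \+ d2); split; first exact: in_spaceD.
  by apply: le_trans (space_normD hX d1X d2X) _; lra.
have y1d := in_spaceD hX y1X d1X; have y2d := in_spaceD hX y2X d2X.
have -> : y1 \+ y2 \+ (d1 \+ d2) = (y1 \+ d1) \+ (y2 \+ d2).
  by apply/funext => v /=; rewrite addrACA.
rewrite (iter_shiftD hX hB)//.
have -> : l k \*o (iter (n k) T (y1 \+ d1) \+ iter (n k) T (y2 \+ d2)) \- (z1 \+ z2) =
    (l k \*o iter (n k) T (y1 \+ d1) \- z1) \+ (l k \*o iter (n k) T (y2 \+ d2) \- z2).
  by apply/funext => v /=; rewrite mulrDr opprD addrACA.
apply: le_trans (space_normD hX _ _) _; last by lra.
- by apply: in_spaceB => //; exact: in_space_orbit.
- by apply: in_spaceB => //; exact: in_space_orbit.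
Qed.

Lemma reachZ (c : K) y z : inX y -> inX z -> reach y z -> reach (c \*o y) (c \*o z).
Proof.
move=> yX zX h e e0; have c0 : 0 < modulus c + 1 by rewrite ltr_wpDl ?modulus_ge0.
have [N hN] := h _ (divr_gt0 e0 c0); exists N => k /hN[d [dX]].
rewrite !ler_pdivlMr// => hd hyd.
have le_e f : inX f -> normX f * (modulus c + 1) <= e -> normX (c \*o f) <= e.
  move=> fX; apply: le_trans; apply: le_trans (space_normZ hX _ fX) _.
  by rewrite mulrC ler_wpM2l ?space_norm_ge0// lerDl.
have ydX := in_spaceD hX yX dX.
exists (c \*o d); split; first exact: in_spaceZ.
  exact: le_e.
have -> : c \*o y \+ c \*o d = c \*o (y \+ d).
  by apply/funext => v /=; rewrite mulrDr.
rewrite (iter_shiftZ hB)//.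
have -> : l k \*o (c \*o iter (n k) T (y \+ d)) \- c \*o z =
    c \*o (l k \*o iter (n k) T (y \+ d) \- z).
  by apply/funext => v /=; rewrite mulrBr mulrCA.
by apply: le_e => //; apply: in_spaceB => //; exact: in_space_orbit.
Qed.

Lemma iter_shift0 k : iter k T vzero = vzero.
Proof.
have -> : vzero = 0 \*o vzero :> (V -> K) by apply/funext => v /=; rewrite mul0r.
by rewrite (iter_shiftZ hB _ _ (in_space0 mu hX)); apply/funext => v /=; rewrite !mul0r.
Qed.

Lemma reach0 : reach vzero vzero.
Proof.
move=> e e0; exists 0%N => k _; exists vzero; split.
- exact: in_space0.
- by rewrite (space_norm0 mu hX) ltW.
have -> : vzero \+ vzero = vzero :> (V -> K).
  by apply/funext => v /=; rewrite addr0.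
rewrite iter_shift0; have -> : l k \*o vzero \- vzero = vzero.
  by apply/funext => v /=; rewrite mulr0 subr0.
by rewrite (space_norm0 mu hX) ltW.
Qed.

Lemma iter_shift_unitvec k v : iter k T (unitvec R b v) = unitvec R b (iter k (par E) v).
Proof.
apply/funext => w; rewrite (iter_shift_supported htree hunrooted k w (@unitvec_supported R b V v)).
rewrite big_mkcond big_seq_fset1 /unitvec eqxx eq_sym.
by case: (_ == _).
Qed.

Lemma iter_shift_thin k v (A : {fset V}) (g : V -> K) : [set` A] `<=` Chin E k v ->
  supported g A -> \sum_(u <- A) g u = 1 -> iter k T g = unitvec R b v.
Proof.
move=> Av gA sg; apply/funext => w; rewrite (iter_shift_supported htree hunrooted k w gA).
have Av' u : u \in A -> iter k (par E) u = v.
  by move=> /Av /(ChinP htree hunrooted).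
rewrite /unitvec; have [->|wv] := eqVneq w v.
  rewrite -sg big_seq_cond [RHS]big_seq; apply: eq_bigl => u.
  by have [/Av' ->|] //= := boolP (u \in A); rewrite eqxx.
rewrite big_seq_cond big1// => u /andP[/Av' -> /eqP vw].
by rewrite vw eqxx in wv.
Qed.

(** The thinness witness [g] is mapped exactly onto the unit vector, so [(l k)^-1 \*o g] reaches it;
    its norm is at most [e] because [g] has norm at most [e * modulus (l k)]. *)
Lemma reach_to_unitvec v : reach vzero (unitvec R b v).
Proof.
move=> e e0; have [N hN] := chi_thin v e0; exists N => k /hN[A [g [Av gA sg ge]]].
have gX := in_space_supported mu hX gA.
exists ((l k)^-1 \*o g); split; first exact: in_spaceZ.
  apply: le_trans (space_normZ hX _ gX) _.
  rewrite (norm_supported mu hX gA) modulusV mulrC.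
  by rewrite ler_pdivrMr ?modulus_gt0.
have -> : vzero \+ (l k)^-1 \*o g = (l k)^-1 \*o g.
  by apply/funext => w /=; rewrite add0r.
rewrite (iter_shiftZ hB)// (iter_shift_thin Av gA sg).
have -> : l k \*o ((l k)^-1 \*o unitvec R b v) \- unitvec R b v = vzero.
  by apply/funext => w /=; rewrite mulrA divff// mul1r subrr.
by rewrite (space_norm0 mu hX) ltW.
Qed.

(** The iterate of the unit vector at [v] is the one at its ancestor. Either its multiple by [l k]
    is already small, or the thinness witness [h] has the same image and subtracting it cancels
    everything. *)
Lemma reach_from_unitvec v : reach (unitvec R b v) vzero.
Proof.
have vX := in_space_unitvec mu hX v.
move=> e e0; have [N hN] := par_thin v e0; exists N => k /hN[small|[A [h [Av hA sh he]]]].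
  exists vzero; split; [exact: in_space0|by rewrite (space_norm0 mu hX) ltW|].
  have -> : unitvec R b v \+ vzero = unitvec R b v.
    by apply/funext => w /=; rewrite addr0.
  rewrite iter_shift_unitvec.
  have -> : l k \*o unitvec R b (iter (n k) (par E) v) \- vzero =
      l k \*o unitvec R b (iter (n k) (par E) v).
    by apply/funext => w /=; rewrite subr0.
  apply: le_trans (space_normZ hX _ (in_space_unitvec mu hX _)) _.
  by rewrite norm_unitvec// -modulusM.
have h_X := in_space_supported mu hX hA.
exists (\- h); split.
- by have := in_spaceB hX (in_space0 mu hX) h_X; congr inX; apply/funext => w /=; rewrite sub0r.
- have -> : \- h = vzero \- h by apply/funext => w /=; rewrite sub0r.
  rewrite space_norm_distC; have -> : h \- vzero = h.
    by apply/funext => w /=; rewrite subr0.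
  by rewrite (norm_supported mu hX hA).
have -> : unitvec R b v \+ \- h = unitvec R b v \- h by [].
rewrite (iter_shiftB hB)// iter_shift_unitvec (iter_shift_thin Av hA sh).
have -> : l k \*o (unitvec R b (iter (n k) (par E) v) \-
    unitvec R b (iter (n k) (par E) v)) \- vzero = vzero.
  by apply/funext => w /=; rewrite subrr mulr0 subr0.
by rewrite (space_norm0 mu hX) ltW.
Qed.

Lemma reach_comb y s : inX y -> reach y (comb s).
Proof.
move=> yX.
have from_comb t : reach (comb t) vzero.
  elim: t => [|[w a] t IH] /=; first exact: reach0.
  have -> : vzero = a \*o vzero \+ vzero :> (V -> K).
    by apply/funext => v /=; rewrite mulr0 addr0.
  have wX := in_space_unitvec mu hX w; have tX := in_space_comb mu hX t.
  apply: reachD => //; [exact: in_spaceZ|exact/in_spaceZ/in_space0|exact: in_space0|].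
  by apply: reachZ => //; [exact: in_space0|exact: reach_from_unitvec].
have to_comb : reach vzero (comb s).
  elim: s => [|[w a] s IH] /=; first exact: reach0.
  have -> : vzero = a \*o vzero \+ vzero :> (V -> K).
    by apply/funext => v /=; rewrite mulr0 addr0.
  have wX := in_space_unitvec mu hX w; have sX := in_space_comb mu hX s.
  apply: reachD => //; [exact/in_spaceZ/in_space0|exact: in_spaceZ|exact: in_space0|].
  by apply: reachZ => //; [exact: in_space0|exact: reach_to_unitvec].
move=> e e0; have e20 : 0 < e / 2 by rewrite divr_gt0.
have [A /(_ A (fun _ => id))] := cutoff_approx hX yX e20.
rewrite cutoff_comb; set t := [seq (w, y w) | w <- enum_fset A] => yt.
have tX := in_space_comb mu hX t; have sX := in_space_comb mu hX s.
have [N hN] := reachD tX (in_space0 mu hX) (in_space0 mu hX) sX (from_comb t) to_comb e20.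
(* The perturbation also replaces [y] by its truncation [comb t], at a cost of [e / 2]. *)
exists N => k /hN[d [dX de hd]]; exists (d \- (y \- comb t)); split.
- by apply: in_spaceB => //; exact: in_spaceB.
- have -> : d \- (y \- comb t) = d \+ (comb t \- y).
    by apply/funext => v /=; rewrite opprB.
  apply: le_trans (space_normD hX dX (in_spaceB hX tX yX)) _.
  by rewrite [X in _ + X]space_norm_distC; lra.
move: hd; have -> : y \+ (d \- (y \- comb t)) = comb t \+ vzero \+ d.
  by apply/funext => v /=; ring.
have -> : vzero \+ comb s = comb s by apply/funext => v /=; rewrite add0r.
by move/le_trans; apply; lra.
Qed.

End ConditionsToSupercyclicity.

(** * Completeness of the space and the construction of a supercyclic vector *)

Section Transitivity.
Variables (R : realType) (b : scalar_kind) (V : countType) (E : rel V).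
Local Notation K := (scalar_field R b).
Variables (mu : V -> K) (X : space_kind R) (Gamma : set K).
Hypotheses (mu_neq0 : forall v, mu v != 0) (hX : admissible X).
Local Notation inX := (in_space mu X).
Local Notation normX := (space_norm mu X).

(** The limit is taken coordinatewise. On a finite set it is compared with [y m] for large [m],
    which removes the factor 2 coming from [scalar_complete]. *)
Lemma space_complete (y : nat -> V -> K) (r : nat -> R) :
    (forall j, inX (y j)) ->
    (forall j m, (j <= m)%N -> normX (y m \- y j) <= r j) ->
    (forall e, 0 < e -> exists N, forall m, (N <= m)%N -> r m <= e) ->
  exists2 x, inX x & forall j, normX (x \- y j) <= r j.
Proof.
move=> yX yr r_to0.
have r_ge0 j : 0 <= r j := le_trans (space_norm_ge0 _ _ _) (yr j j (leqnn j)).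
have [x hx] : exists x : V -> K, forall v j,
    modulus (x v - y j v) <= 2 * (r j / modulus (mu v)).
  have [|x hx] := @choice _ _ (fun v (z : K) => forall j,
      modulus (z - y j v) <= 2 * (r j / modulus (mu v))); last by exists x.
  move=> v; apply: scalar_complete => j m jm.
  rewrite ler_pdivlMr ?modulus_gt0//.
  exact: le_trans (norm_coord hX v (in_spaceB hX (yX m) (yX j))) (yr _ _ jm).
have xr j F : finnorm mu X F (x \- y j) <= r j.
  apply/ler_addgt0Pr => e e0.
  (* Each of the [size F] coordinates of [x \- y m] contributes at most [2 * r m], and their total
     has to stay below [e]. *)
  have s0 : 0 < 2 * (size F)%:R + 1 :> R by rewrite ltr_wpDl// mulr_ge0.
  have [N hN] := r_to0 _ (divr_gt0 e0 s0).
  pose m := maxn N j; have := hN m (leq_maxl _ _).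
  rewrite ler_pdivlMr// => rm.
  have -> : x \- y j = (x \- y m) \+ (y m \- y j).
    by apply/funext => v /=; rewrite addrA subrK.
  apply: le_trans (finnormD mu hX _ _ _) _; rewrite addrC; apply: lerD.
    apply: le_trans (yr _ _ (leq_maxr N j)).
    by apply: finnorm_le_norm => //; exact: in_spaceB.
  apply: le_trans (finnorm_le_sum mu hX _ _) _.
  apply: (@le_trans _ _ (\sum_(v <- F) (2 * r m))).
    apply: ler_sum => v _; rewrite modulusM /= -ler_pdivlMr ?modulus_gt0//.
    by rewrite -mulrA.
  rewrite big_const_seq count_predT iter_addr addr0 -mulr_natr.
  by have := r_ge0 m; nra.
have xX : inX x.
  apply: in_space_near => // e e0; have [N hN] := r_to0 _ e0.
  by exists (y N) => // F; exact: le_trans (xr N F) (hN N (leqnn N)).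
exists x => // j; apply: space_norm_le => //; exact: in_spaceB.
Qed.

Hypothesis hB : bounded_backward_shift E mu X.
Local Notation T := (@backward_shift R b V E).

Lemma supercyclic_of_transitive :
    (forall y s e, inX y -> 0 < e -> exists n l d,
      [/\ Gamma l, inX d, normX d <= e &
          normX (l \*o iter n T (y \+ d) \- rat_comb R b s) <= e]) ->
  supercyclic mu X Gamma T.
Proof.
move=> trans.
have step s e r y : 0 < e -> 0 < r -> inX y -> exists y' r' n l,
    [/\ [/\ inX y', 0 < r', r' <= e & Gamma l], normX (y' \- y) + r' <= r &
      forall x, inX x -> normX (x \- y') <= r' ->
        normX (l \*o iter n T x \- rat_comb R b s) <= e].
  move=> e0 r0 yX.
  have [c c0 [ce cr]] : exists2 c : R, 0 < c & c <= e / 2 /\ c <= r / 2.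
    exists (Num.min (e / 2) (r / 2)); first by rewrite lt_min !divr_gt0.
    by rewrite !ge_min !lexx orbT.
  have [n [l [d [Gl dX dc hd]]]] := trans y s c yX c0.
  have [C C0 hC] := iter_shift_bounded hB n.
  have lC0 : 0 < modulus l * C + 1 by rewrite ltr_wpDl// mulr_ge0 ?modulus_ge0// ltW.
  have ydX := in_spaceD hX yX dX.
  have r'0 : 0 < c / (modulus l * C + 1) by rewrite divr_gt0.
  have r'c : c / (modulus l * C + 1) <= c.
    rewrite ler_pdivrMr// ler_peMr ?(ltW c0)// lerDr mulr_ge0 ?modulus_ge0//.
    exact: ltW.
  exists (y \+ d), (c / (modulus l * C + 1)), n, l; split; first split=> //.
  - by apply: le_trans r'c _; lra.
  - have -> : (y \+ d) \- y = d by apply/funext => v /=; rewrite addrC addKr.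
    lra.
  move=> x xX; rewrite ler_pdivlMr// => hx.
  have lTX z : inX z -> inX (l \*o iter n T z).
    by move=> zX; apply: in_spaceZ => //; exact: in_space_iter_shift.
  have sX : inX (rat_comb R b s) := in_space_comb mu hX _.
  have := space_norm_tri hX (lTX _ xX) (lTX _ ydX) sX.
  suff : normX (l \*o iter n T x \- l \*o iter n T (y \+ d)) <= c.
    by move: hd ce; lra.
  have -> : l \*o iter n T x \- l \*o iter n T (y \+ d) = l \*o iter n T (x \- (y \+ d)).
    by rewrite (iter_shiftB hB n xX ydX); apply/funext => v /=; rewrite mulrBr.
  have xydX := in_spaceB hX xX ydX.
  apply: le_trans (space_normZ hX _ (in_space_iter_shift hB _ xydX)) _.
  apply: le_trans (ler_wpM2l (modulus_ge0 _) (hC _ xydX)) _.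
  by apply: le_trans hx; rewrite mulrA mulrC ler_wpM2l ?space_norm_ge0// lerDl.
(* Stage [j] treats the pair of a rational combination and a precision coded by [j], with a harmless
   default for non-codes. In [bound], the term [j.+1%:R^-1] drives the radii to 0. *)
pose target j := odflt ([::], 0%N) (choice.unpickle j : option (seq (V * (rat * rat)) * nat)).
pose prec j : R := (target j).2.+1%:R^-1.
pose bound j : R := Num.min (prec j) j.+1%:R^-1.
have bound_gt0 j : 0 < bound j by rewrite lt_min !invr_gt0 !ltr0n.
have [|Phi hPhi] := @choice _ _ (fun (a : nat * ((V -> K) * R)) (o : (V -> K) * R * (nat * K)) =>
    inX a.2.1 -> 0 < a.2.2 ->
    [/\ [/\ inX o.1.1, 0 < o.1.2, o.1.2 <= bound a.1 & Gamma o.2.2],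
      normX (o.1.1 \- a.2.1) + o.1.2 <= a.2.2 &
      forall x, inX x -> normX (x \- o.1.1) <= o.1.2 ->
        normX (o.2.2 \*o iter o.2.1 T x \- rat_comb R b (target a.1).1) <= bound a.1]).
  move=> [j [y r]]; have [[yX r0]|h] := pselect (inX y /\ 0 < r); last first.
    by exists (y, r, (0%N, 0)) => yX r0; case: h.
  by have [y' [r' [n [l ?]]]] := step (target j).1 _ _ _ (bound_gt0 j) r0 yX;
    exists (y', r', (n, l)).
pose st := fix st j := if j is j'.+1 then (Phi (j', st j')).1 else ((fun=> 0) : V -> K, 1 : R).
have st_ok j : inX (st j).1 /\ 0 < (st j).2.
  elim: j => [|j [yX r0]] /=; first by split=> //; exact: in_space0.
  by have [[]] := hPhi (j, st j) yX r0.
have hst j := hPhi (j, st j) (st_ok j).1 (st_ok j).2.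
have yr j m : (j <= m)%N -> normX ((st m).1 \- (st j).1) + (st m).2 <= (st j).2.
  move=> /subnK <-; elim: (m - j)%N => [|i IH].
    rewrite add0n (_ : _ \- _ = (fun=> 0)) ?space_norm0 ?add0r//.
    by apply/funext => v /=; rewrite subrr.
  have [_ h _] := hst (i + j)%N; apply: le_trans IH; rewrite -/(st (i + j).+1) /= in h *.
  have := space_norm_tri hX (st_ok (i + j).+1).1 (st_ok (i + j)%N).1 (st_ok j).1.
  by move: h; rewrite /=; lra.
have [|j m jm|e e0|x xX hx] := @space_complete (fun j => (st j).1) (fun j => (st j).2).
- by move=> j; exact: (st_ok j).1.
- by have := yr j m jm; have := (st_ok m).2; lra.
- exists (Num.bound e^-1).+1 => -[//|m]; rewrite ltnS => em.
  have [[_ _ h _] _ _] := hst m; apply: le_trans h _.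
  by rewrite ge_min (invS_le e0 em) orbT.
exists x => // f fX e e0.
have e30 : 0 < e / 3 by rewrite divr_gt0.
have [s hs] := rat_comb_dense hX fX e30.
pose j := choice.pickle (s, Num.bound (e / 3)^-1).
have tj : target j = (s, Num.bound (e / 3)^-1) by rewrite /target choice.pickleK.
have [[_ _ _ Gl] _ /(_ x xX (hx j.+1))] := hst j; rewrite /= tj /= => hj.
set n := (Phi (j, st j)).2.1 in hj; set l := (Phi (j, st j)).2.2 in Gl hj.
have lTX : inX (l \*o iter n T x).
  by apply: in_spaceZ => //; exact: in_space_iter_shift.
exists (l \*o iter n T x); split; first by exists l => //; exists n.
split=> //; have := space_norm_tri hX lTX (in_space_comb mu hX _ : inX (rat_comb R b s)) fX.
have : bound j <= e / 3.
  by rewrite ge_min /prec tj /= (invS_le e30 (leqnn _)).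
by move: hs; rewrite space_norm_distC; lra.
Qed.

End Transitivity.

(** * From supercyclicity to recurrence *)

Section SupercyclicToRecurrent.
Variables (R : realType) (b : scalar_kind) (V : countType) (E : rel V).
Local Notation K := (scalar_field R b).
Variables (mu : V -> K) (X : space_kind R) (Gamma : set K).
Hypotheses (htree : directed_tree E) (hunrooted : unrooted E).
Hypotheses (mu_neq0 : forall v, mu v != 0) (hX : admissible X).
Hypothesis hB : bounded_backward_shift E mu X.
Local Notation T := (@backward_shift R b V E).
Local Notation inX := (in_space mu X).
Local Notation normX := (space_norm mu X).
Variable x : V -> K.
Hypothesis xX : inX x.
Hypothesis orbit_dense : dense_in_space mu X
  [set y | exists2 l, Gamma l & exists n : nat, y = l \*o iter n T x].

Let orbitX l n : inX (l \*o iter n T x).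
Proof. by apply: in_spaceZ => //; exact: in_space_iter_shift. Qed.

(* A linear functional on two coordinates that kills [x] separates a vector
   arbitrarily close to [f] from the line spanned by [x]. *)
Lemma positive_orbit_dense f e : inX f -> 0 < e -> exists n l,
  Gamma l /\ normX (l \*o iter n.+1 T x \- f) <= e.
Proof.
move=> fX e0; have [v0 _] := tree_nonempty htree.
(* The orbit of the zero vector is at most the zero vector, which is not closer than
   [modulus (mu v0)] to the unit vector at [v0]. *)
have [v xv] : exists v, x v != 0.
  apply: contrapT => x0.
  have x_eq0 : x = fun=> 0.
    by apply/funext => v; apply/eqP/negPn/negP => xv; apply: x0; exists v.
  have v0X := in_space_unitvec mu hX v0.
  have [|_ [[l _ [n ->]] [_]]] := orbit_dense v0X (e := modulus (mu v0)).
    by rewrite modulus_gt0.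
  rewrite x_eq0 (iter_shift0 hX hB).
  rewrite space_norm_distC (_ : _ \- _ = unitvec R b v0) ?norm_unitvec ?ltxx//.
  by apply/funext => w /=; rewrite mulr0 subr0.
pose w := par E v; have wv : v != w.
  by apply/eqP => vw; exact: (@iter_par_neq _ _ htree hunrooted 0 v (esym vw)).
have mv0 : 0 < modulus (mu v) by rewrite modulus_gt0.
have mw0 : 0 < modulus (mu w) by rewrite modulus_gt0.
pose c := x w / x v; pose phi (g : V -> K) := g w - c * g v.
pose M := (modulus (mu w))^-1 + modulus c / modulus (mu v).
have M0 : 0 < M by rewrite ltr_pwDl ?invr_gt0// divr_ge0 ?modulus_ge0.
have phiM g : inX g -> modulus (phi g) <= normX g * M.
  move=> gX; apply: le_trans (modulusD _ _) _; rewrite modulusN modulusM mulrDr.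
  apply: lerD; first by rewrite ler_pdivlMr//; exact: norm_coord.
  rewrite mulrCA ler_wpM2l ?modulus_ge0// ler_pdivlMr//; exact: norm_coord.
have e20 : 0 < e / 2 by rewrite divr_gt0.
have [f' [f'X ff' phif']] : exists f',
    [/\ inX f', normX (f' \- f) <= e / 2 & phi f' != 0].
  have [phif|phif] := eqVneq (phi f) 0; last first.
    exists f; split=> //; rewrite (_ : _ \- _ = fun=> 0) ?space_norm0 ?ltW//.
    by apply/funext => u /=; rewrite subrr.
  pose s := of_real b (e / 2 / modulus (mu w)).
  have sE : modulus s = e / 2 / modulus (mu w).
    by rewrite modulus_of_real ger0_norm// ltW// divr_gt0.
  have wX := in_space_unitvec mu hX w; have swX := in_spaceZ hX s wX.
  exists (f \+ s \*o unitvec R b w); split; first exact: in_spaceD.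
    rewrite (_ : _ \- f = s \*o unitvec R b w); last first.
      by apply/funext => u /=; rewrite addrC addKr.
    apply: le_trans (space_normZ hX _ wX) _.
    by rewrite norm_unitvec// sE divfK// gt_eqF.
  have -> : phi (f \+ s \*o unitvec R b w) = phi f + s.
    by rewrite /phi /= /unitvec eqxx (negbTE wv) mulr1 mulr0 addr0 addrAC.
  by rewrite phif add0r -modulus_gt0 sE divr_gt0.
have d0 : 0 < Num.min (e / 2) (modulus (phi f') / M).
  by rewrite lt_min e20 divr_gt0// modulus_gt0.
have [_ [[l Gl [n ->]] [_]]] := orbit_dense f'X d0.
rewrite lt_min => /andP[near_e near_phi]; case: n near_e near_phi => [|n] near_e near_phi.
  (* Since [phi] vanishes on multiples of [x], these stay at distance at least
     [modulus (phi f') / M] from [f']; this excludes the exponent 0. *)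
  have := phiM _ (in_spaceB hX (orbitX l 0) f'X).
  have -> : phi (l \*o iter 0 T x \- f') = - phi f'.
    have cx : c * x v = x w by rewrite divfK.
    by rewrite /phi /= mulrBr mulrCA cx !opprB addrC addrA subrK.
  by rewrite modulusN leNgt -ltr_pdivlMr// near_phi.
exists n, l; split=> //.
have := space_norm_tri hX (orbitX l n.+1) f'X fX; move: near_e ff'; lra.
Qed.

(** Induction on [N]: [f] is close to the shift of some [l1 \*o iter m T x], which by induction is
    close to an orbit vector with exponent at least [N]; one more shift raises the exponent. *)
Lemma orbit_tail_dense N f e : inX f -> 0 < e -> exists n l,
  [/\ (N <= n)%N, Gamma l & normX (l \*o iter n T x \- f) <= e].
Proof.
elim: N f e => [|N IH] f e fX e0.
  have [_ [[l Gl [n ->]] [_ /ltW near_f]]] := orbit_dense fX e0.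
  by exists n, l.
have e20 : 0 < e / 2 by rewrite divr_gt0.
have [m [l1 [_ near_f]]] := positive_orbit_dense fX e20.
have [C C0 hC] := iter_shift_bounded hB 1.
have [n [l [Nn Gl]]] := IH _ _ (orbitX l1 m) (divr_gt0 e20 C0).
rewrite ler_pdivlMr// => near_g; exists n.+1, l; split=> //.
have := space_norm_tri hX (orbitX l n.+1) (orbitX l1 m.+1) fX.
suff : normX (l \*o iter n.+1 T x \- l1 \*o iter m.+1 T x) <= e / 2 by lra.
have TE k (a : K) : a \*o iter k.+1 T x = iter 1 T (a \*o iter k T x).
  by rewrite (iter_shiftZ hB 1)//; exact: in_space_iter_shift.
rewrite !TE -(iter_shiftB hB 1 (orbitX l n) (orbitX l1 m)).
apply: le_trans (hC _ (in_spaceB hX (orbitX l n) (orbitX l1 m))) _.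
by rewrite mulrC.
Qed.

(** The tails of the orbit approach [x] itself, and recurrence passes to [l0 \*o iter m T x] because
    multiples of iterates commute and are bounded. *)
Lemma orbit_recurrent l0 m : recurrent_vector mu X Gamma T (l0 \*o iter m T x).
Proof.
split; first exact: orbitX.
have [|n [l [n0 n_incr hnl]]] := @choose_increasing K (fun k n l =>
    Gamma l /\ normX (l \*o iter n T x \- x) <= k.+1%:R^-1).
  move=> k N; have k0 : 0 < k.+1%:R^-1 :> R by rewrite invr_gt0.
  by have [n [l [? ? ?]]] := orbit_tail_dense N xX k0; exists n, l.
exists n, l; split=> //; first by move=> k; exact: (hnl k).1.
have [C C0 hC] := iter_shift_bounded hB m.
have c0 : 0 < modulus l0 * C + 1 by rewrite ltr_wpDl// mulr_ge0 ?modulus_ge0// ltW.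
apply/cvgrPdist_le => e e0; apply/near_inftyP.
exists (Num.bound (e / (modulus l0 * C + 1))^-1) => k hk.
rewrite sub0r normrN ger0_norm ?space_norm_ge0//.
have zX := in_spaceB hX (orbitX (l k) (n k)) xX.
have -> : l k \*o iter (n k) T (l0 \*o iter m T x) \- l0 \*o iter m T x =
    l0 \*o iter m T (l k \*o iter (n k) T x \- x).
  rewrite (iter_shiftB hB m (orbitX _ _) xX).
  rewrite (iter_shiftZ hB (n k) _ (in_space_iter_shift hB m xX)).
  rewrite (iter_shiftZ hB m _ (in_space_iter_shift hB (n k) xX)).
  by rewrite -!iterD addnC; apply/funext => v /=; rewrite mulrBr mulrCA.
apply: le_trans (space_normZ hX _ (in_space_iter_shift hB _ zX)) _.
apply: le_trans (ler_wpM2l (modulus_ge0 _) (hC _ zX)) _.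
have := le_trans (hnl k).2 (invS_le (divr_gt0 e0 c0) hk).
rewrite ler_pdivlMr// => h; apply: le_trans h.
by rewrite mulrA mulrC ler_wpM2l ?space_norm_ge0// lerDl.
Qed.

End SupercyclicToRecurrent.

(** * The cycle of implications *)

Theorem theorem6p1 (R : realType) (b : scalar_kind) (V : countType)
    (E : rel V) (mu : V -> scalar_field R b) (Gamma : set (scalar_field R b))
    (X : space_kind R)
    (htree : directed_tree E) (hunrooted : unrooted E)
    (hmu : forall v, mu v != 0) (hX : admissible X)
    (hB : bounded_backward_shift E mu X) :
  [<->
    supercyclic mu X Gamma (backward_shift E);
    recurrent mu X Gamma (backward_shift E);
    exists (n : nat -> nat) (l : nat -> scalar_field R b),
      [/\ (forall k, 0 < n k)%N, (forall k, n k < n k.+1)%N,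
          (forall k, Gamma (l k) /\ l k != 0) &
          forall v : V,
          match X with
          | Ellp p =>
              if p == 1 then
                ereal_inf [set (modulus (mu u) / modulus (l k))%:E
                          | u in Chin E (n k) v] @[k --> \oo] --> 0%E
              else
                (\esum_(u in Chin E (n k) v)
                  (modulus (l k) `^ conj_exponent p
                   / modulus (mu u) `^ conj_exponent p)%:E)
                  @[k --> \oo] --> +oo%E
          | C0 =>
              (\esum_(u in Chin E (n k) v)
                (modulus (l k) / modulus (mu u))%:E) @[k --> \oo] --> +oo%E
          end
          /\
          match X with
          | Ellp p =>
              if p == 1 then
                Order.min
                  (modulus (l k * mu (iter (n k) (par E) v)))%:E
                  (ereal_inf [set (modulus (mu u))%:E
                    | u in Chin E (n k) (iter (n k) (par E) v)])
                  @[k --> \oo] --> 0%E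
              else
                ((modulus (l k * mu (iter (n k) (par E) v))
                    `^ conj_exponent p)^-1%:E
                 + \esum_(u in Chin E (n k) (iter (n k) (par E) v))
                     (modulus (mu u) `^ conj_exponent p)^-1%:E)%E
                  @[k --> \oo] --> +oo%E
          | C0 =>
              ((modulus (l k * mu (iter (n k) (par E) v)))^-1%:E
               + \esum_(u in Chin E (n k) (iter (n k) (par E) v))
                   (modulus (mu u))^-1%:E)%E @[k --> \oo] --> +oo%E
          end]
  ].
Proof.
tfae.
- move=> [x xX orbit_dense] f fX e e0.
  have [_ [[l Gl [n ->]] near_f]] := orbit_dense f fX e e0.
  exists (l \*o iter n (backward_shift E) x); split=> //.
  exact: orbit_recurrent.
- move=> hrec.
  have [n [l [n0 n_incr Gl hthin]]] := recurrent_conditions htree hunrooted hmu hX hB hrec.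
  exists n, l; split=> // v; split.
    apply/(chi_conditionP hX hmu (fun k => Chin E (n k) v)) => [k|e e0].
      exact: (Gl k).2.
    by have [N hN] := hthin v e e0; exists N => k /hN[].
  apply/(par_conditionP hX hmu (fun k => Chin E (n k) (iter (n k) (par E) v))
    (l := fun k => l k * mu (iter (n k) (par E) v))) => [k|e e0].
    by rewrite mulf_neq0// (Gl k).2.
  by have [N hN] := hthin v e e0; exists N => k /hN[].
- move=> [n [l [n0 n_incr Gl hcond]]].
  have l0 k : l k != 0 := (Gl k).2.
  have chi_thin v e : 0 < e -> exists N, forall k, (N <= k)%N ->
      thin X mu (Chin E (n k) v) (e * modulus (l k)).
    exact: (chi_conditionP hX hmu (fun k => Chin E (n k) v) l0).1 (hcond v).1 e.
  have par_thin v e : 0 < e -> exists N, forall k, (N <= k)%N ->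
      modulus (l k * mu (iter (n k) (par E) v)) <= e \/
      thin X mu (Chin E (n k) (iter (n k) (par E) v)) e.
    have lmu0 k : l k * mu (iter (n k) (par E) v) != 0 by rewrite mulf_neq0.
    exact: (par_conditionP hX hmu (fun k => Chin E (n k) (iter (n k) (par E) v))
      lmu0).1 (hcond v).2 e.
  apply: (supercyclic_of_transitive hmu hX hB) => y s e yX e0.
  have [N hN] := reach_comb htree hunrooted hX hB l0 chi_thin par_thin
    [seq (t.1, of_rat2 R b t.2) | t <- s] yX e0.
  (* A single large index is enough for transitivity. *)
  have [d [dX de hd]] := hN N (leqnn N).
  by exists (n N), (l N), d; split=> //; exact: (Gl N).1.
Qed.
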